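(* Let $n-3\ge p\ge 2$ and let $f:M^n\to\mathbb{R}^{n+p}$ be a proper umbilic-free isometric immersion with flat normal bundle of a conformally flat manifold, with closed Moebius form, having a principal normal vector field $\eta$ of multiplicity $n-p+\ell$, $0\le\ell\le p-2$. Let $X_1,\dots,X_n$ be an orthonormal frame with respect to the Moebius metric $\langle\,,\rangle^*$ that diagonalizes simultaneously the Moebius second fundamental form $\beta$ and the Blaschke tensor $\psi$, with $\beta(X_i,X_i)=\bar\eta$ for $p-\ell+1\le i\le n$, and let $\Delta=E_\eta=\operatorname{span}\{X_i:p-\ell+1\le i\le n\}$. Then the net $\mathcal{E}=\{\operatorname{span}\{X_1\},\dots,\operatorname{span}\{X_{p-\ell}\},\Delta\}$ in $(M^n,\langle\,,\rangle^* )$ is a TP-net.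
   Context: A net on a manifold $M$ is a splitting $TM=\bigoplus_i E_i$ of its tangent bundle into a family of integrable distributions; on a Riemannian manifold it is orthogonal if the $E_i$ are mutually orthogonal. A distribution $E$ on a Riemannian manifold is umbilical if there is a smooth section $\delta$ of $E^\perp$ (its mean curvature vector field) with $\langle\nabla_TS,X\rangle=\langle T,S\rangle\langle\delta,X\rangle$ for all $T,S\in\Gamma(E)$, $X\in\Gamma(E^\perp)$. An orthogonal net $(E_i)$ is a TP-net if each $E_i$ is umbilical and each $E_i^\perp$ is integrable. For an isometric immersion $f:M^n\to\mathbb{R}^m$ with second fundamental form $\alpha^f$, mean curvature vector field $\mathcal{H}^f=\frac1n\operatorname{tr}\alpha^f$, normal bundle $N_fM$, a normal vector $\eta$ at $x$ is a principal normal of multiplicity $s$ if $E_\eta(x)=\{X\in T_xM:\alpha^f(X,Y)=\langle X,Y\rangle\eta\ \forall\, Y\in T_xM\}$ has dimension $s>0$. If $f$ has flat normal bundle (vanishing normal curvature), $T_xM$ is the orthogonal direct sum of the $E_{\eta_i}(x)$ over the distinct principal normals at $x$; $f$ is proper if their number is constant. For $f$ umbilic-free with induced metric $\langle\,,\rangle_f$, let $\rho>0$, $\rho^2=\frac{n}{n-1}(\|\alpha^f\|^2-n\|\mathcal{H}^f\|^2)$. The Moebius metric is $\langle\,,\rangle^*=\rho^2\langle\,,\rangle_f$ (objects computed with it carry a $*$); the Moebius second fundamental form is $\beta(X,Y)=\rho(\alpha^f(X,Y)-\langle X,Y\rangle_f\mathcal{H}^f)$; the Blaschke tensor is $\psi(X,Y)=\frac1\rho\langle\beta(X,Y),\mathcal{H}^f\rangle+\frac{1}{2\rho^2}(\|\operatorname{grad}^*\rho\|_*^2+\|\mathcal{H}^f\|^2)\langle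 X,Y\rangle^*-\frac1\rho\operatorname{Hess}^*\rho(X,Y)$; the Moebius form is the $N_fM$-valued one-form $\omega(X)=-\frac1\rho(\nabla^\perp_X\mathcal{H}^f+\beta(X,\operatorname{grad}^*\rho))$, closed if $d\omega(X,Y)=\nabla^\perp_X\omega(Y)-\nabla^\perp_Y\omega(X)-\omega([X,Y])=0$. The Moebius principal normal associated with $\eta$ is $\bar\eta=\rho^{-1}(\eta-\mathcal{H}^f)$. Under the hypotheses, the remaining $p-\ell$ principal normal vector fields of $f$ are simple (multiplicity one), and a (local) frame $X_1,\dots,X_n$ as in the statement exists. *)

(* Defs.v *)
From HB Require Import structures.
From mathcomp Require Import all_boot all_order all_algebra.
From mathcomp Require Import all_classical all_reals all_analysis.
Set Implicit Arguments.
Unset Strict Implicit.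
Unset Printing Implicit Defensive.
Import Order.TTheory GRing.Theory Num.Theory.
Import numFieldNormedType.Exports.
Local Open Scope classical_set_scope.
Local Open Scope ring_scope.

(* C^k and C^oo maps on an open set O, through iterated directional
   derivatives; nothing is required outside O. *)
Fixpoint Ck {R : realType} {V W : normedModType R} (k : nat) (O : set V)
    (h : V -> W) : Prop :=
  match k with
  | 0 => forall x, O x -> {for x, continuous h}
  | k'.+1 => (forall x, O x -> differentiable h x) /\
             (forall v, Ck k' O (fun x => 'D_v h x))
  end.

Definition smooth {R : realType} {V W : normedModType R} (O : set V)
  (h : V -> W) : Prop := forall k, Ck k O h.

(* The norm of 'rV[R]_m in the library is the sup norm; the Euclidean
   structure is carried by dotp. *)
Definition dotp {R : realType} {m : nat} (u v : 'rV[R]_m) : R :=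
  \sum_(i < m) u 0 i * v 0 i.

(* cmap and cinv are total functions, meaningful only on cdom and on its
   image. *)
Record chart (R : realType) (n : nat) (T : topologicalType) := Chart {
  cdom : set T;
  cmap : T -> 'rV[R]_n;
  cinv : 'rV[R]_n -> T }.

Definition is_chart {R : realType} {n : nat} {T : topologicalType}
    (c : chart R n T) : Prop :=
  [/\ open (cdom c), open (cmap c @` cdom c),
      forall x, cdom c x -> cinv c (cmap c x) = x,
      forall x, cdom c x -> {for x, continuous (cmap c)} &
      forall y, (cmap c @` cdom c) y -> {for y, continuous (cinv c)}].

Definition smooth_transition {R : realType} {n : nat} {T : topologicalType}
    (c c' : chart R n T) : Prop :=
  smooth (cmap c @` (cdom c `&` cdom c')) (cmap c' \o cinv c).

(* Smooth n-manifolds without boundary, not assumed connected.  The record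
   also chooses a chart around each point, which serves to identify T_xM with
   R^n; another choice only changes this identification. *)
Record manifold (R : realType) (n : nat) := Manifold {
  carrier :> topologicalType;
  atlas : set (chart R n carrier);
  chart_at : carrier -> chart R n carrier;
  man_hausdorff : hausdorff_space carrier;
  man_second_countable : @second_countable carrier;
  atlas_chart : forall c, atlas c -> is_chart c;
  atlas_smooth : forall c c', atlas c -> atlas c' -> smooth_transition c c';
  chart_at_atlas : forall x, atlas (chart_at x);
  chart_at_dom : forall x, cdom (chart_at x) x }.

(* The charts of the maximal atlas. *)
Definition smooth_chart {R : realType} {n : nat} (M : manifold R n)
    (c : chart R n M) : Prop :=
  is_chart c /\
  forall c', atlas c' -> smooth_transition c c' /\ smooth_transition c' c.

Definition smooth_fun {R : realType} {n : nat} {M : manifold R n}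
    {W : normedModType R} (V : set M) (h : M -> W) : Prop :=
  forall c, atlas c -> smooth (cmap c @` (V `&` cdom c)) (h \o cinv c).

(* T_xM is 'rV[R]_n, the vector u being the class of the curve
   t |-> phi^-1 (phi x + t u) with phi = chart_at x.  dM h x is the
   differential of h at x. *)
Definition dM {R : realType} {n : nat} {M : manifold R n}
    {W : normedModType R} (h : M -> W) (x : M) (u : 'rV[R]_n) : W :=
  'D_u (h \o cinv (chart_at x)) (cmap (chart_at x) x).

Definition vfield {R : realType} {n : nat} (M : manifold R n) :=
  M -> 'rV[R]_n.

(* The derivative X(h). *)
Definition vder {R : realType} {n : nat} {M : manifold R n}
    {W : normedModType R} (X : vfield M) (h : M -> W) : M -> W :=
  fun x => dM h x (X x).

(* vder X (cmap c) is the column of components of X in the chart c. *)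
Definition smooth_vf {R : realType} {n : nat} {M : manifold R n}
    (V : set M) (X : vfield M) : Prop :=
  forall c, atlas c -> smooth_fun (V `&` cdom c) (vder X (cmap c)).

(* [X,Y]^i = X(Y^i) - Y(X^i), the components being those in chart_at x. *)
Definition bracket {R : realType} {n : nat} {M : manifold R n}
    (X Y : vfield M) : vfield M :=
  fun x => vder X (vder Y (cmap (chart_at x))) x
           - vder Y (vder X (cmap (chart_at x))) x.

Definition metric_field {R : realType} {n : nat} (M : manifold R n) :=
  M -> 'rV[R]_n -> 'rV[R]_n -> R.

Definition riemannian {R : realType} {n : nat} {M : manifold R n}
    (g : metric_field M) : Prop :=
  [/\ forall x (a : R) u v w, g x (a *: u + v) w = a * g x u w + g x v w,
      forall x u v, g x u v = g x v u,
      forall x u, u != 0 -> 0 < g x u u &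
      forall (V : set M) (X Y : vfield M), open V ->
        smooth_vf V X -> smooth_vf V Y ->
        smooth_fun V (fun x => g x (X x) (Y x))].

Definition gram {R : realType} {n : nat} {M : manifold R n}
    (g : metric_field M) (x : M) : 'M[R]_n :=
  \matrix_(i, j) g x (delta_mx 0 i) (delta_mx 0 j).

Definition grad {R : realType} {n : nat} {M : manifold R n}
    (g : metric_field M) (h : M -> R) : vfield M :=
  fun x => (\row_i dM h x (delta_mx 0 i)) *m invmx (gram g x).

Definition conformally_flat {R : realType} {n : nat} {M : manifold R n}
    (g : metric_field M) : Prop :=
  forall x : M, exists (c : chart R n M) (lambda : M -> R),
    [/\ smooth_chart c, cdom c x, smooth_fun (cdom c) lambda,
        forall y, cdom c y -> 0 < lambda y &
        forall y u v, cdom c y ->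
          g y u v = lambda y * dotp (dM (cmap c) y u) (dM (cmap c) y v)].

(* The axioms are imposed on smooth fields over arbitrary open sets, so that
   they determine nabla X Y x for fields smooth near x. *)
Definition levi_civita {R : realType} {n : nat} {M : manifold R n}
    (g : metric_field M) (nabla : vfield M -> vfield M -> vfield M) : Prop :=
  forall (V : set M) (X Y Z : vfield M) (h : M -> R), open V ->
    smooth_vf V X -> smooth_vf V Y -> smooth_vf V Z -> smooth_fun V h ->
    smooth_vf V (nabla X Y) /\
    forall x, V x ->
      [/\ nabla (fun y => h y *: X y + Z y) Y x
            = h x *: nabla X Y x + nabla Z Y x,
          nabla X (fun y => Y y + Z y) x = nabla X Y x + nabla X Z x,
          nabla X (fun y => h y *: Y y) x
            = vder X h x *: Y x + h x *: nabla X Y x,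
          nabla X Y x - nabla Y X x = bracket X Y x &
          vder X (fun y => g y (Y y) (Z y)) x
            = g x (nabla X Y x) (Z x) + g x (Y x) (nabla X Z x)].

Definition hess {R : realType} {n : nat} {M : manifold R n}
    (nabla : vfield M -> vfield M -> vfield M) (h : M -> R)
    (X Y : vfield M) (x : M) : R :=
  vder X (vder Y h) x - vder (nabla X Y) h x.

(* Distributions and nets. *)

Definition distr {R : realType} {n : nat} (M : manifold R n) :=
  M -> set 'rV[R]_n.

Definition smooth_distr {R : realType} {n : nat} {M : manifold R n}
    (U : set M) (E : distr M) : Prop :=
  exists r : nat, forall x, U x ->
    exists (V : set M) (Y : 'I_r -> vfield M),
      [/\ open V, V x, V `<=` U, forall i, smooth_vf V (Y i) &
          forall y, V y -> row_free (\matrix_(i < r) Y i y) /\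
            E y = [set v : 'rV[R]_n | (v <= \matrix_(i < r) Y i y)%MS]].

Definition local_section {R : realType} {n : nat} {M : manifold R n}
    (V : set M) (E : distr M) (X : vfield M) : Prop :=
  smooth_vf V X /\ forall x, V x -> E x (X x).

(* Integrability in the sense of Frobenius: local sections are closed under
   the Lie bracket. *)
Definition integrable_distr {R : realType} {n : nat} {M : manifold R n}
    (U : set M) (E : distr M) : Prop :=
  smooth_distr U E /\
  forall (V : set M) (X Y : vfield M), open V -> V `<=` U ->
    local_section V E X -> local_section V E Y ->
    forall x, V x -> E x (bracket X Y x).

Definition orth_distr {R : realType} {n : nat} {M : manifold R n}
    (g : metric_field M) (E : distr M) : distr M :=
  fun x => [set v | forall u, E x u -> g x u v = 0].

Definition umbilical {R : realType} {n : nat} {M : manifold R n}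
    (g : metric_field M) (nabla : vfield M -> vfield M -> vfield M)
    (U : set M) (E : distr M) : Prop :=
  exists delta : vfield M, local_section U (orth_distr g E) delta /\
    forall (V : set M) (T S X : vfield M), open V -> V `<=` U ->
      local_section V E T -> local_section V E S ->
      local_section V (orth_distr g E) X ->
      forall x, V x ->
        g x (nabla T S x) (X x) = g x (T x) (S x) * g x (delta x) (X x).

(* The first clause says that T_xM is the direct sum of the E i x. *)
Definition net {R : realType} {n : nat} {M : manifold R n} {I : finType}
    (U : set M) (E : I -> distr M) : Prop :=
  (forall x, U x -> forall v : 'rV[R]_n,
     exists! u : {ffun I -> 'rV[R]_n},
       (forall i, E i x (u i)) /\ v = \sum_i u i) /\
  forall i, integrable_distr U (E i).

Definition orthogonal_net {R : realType} {n : nat} {M : manifold R n}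
    {I : finType} (g : metric_field M) (U : set M) (E : I -> distr M) : Prop :=
  net U E /\
  forall x, U x -> forall (i j : I) (u v : 'rV[R]_n),
    i != j -> E i x u -> E j x v -> g x u v = 0.

Definition TP_net {R : realType} {n : nat} {M : manifold R n} {I : finType}
    (g : metric_field M) (nabla : vfield M -> vfield M -> vfield M)
    (U : set M) (E : I -> distr M) : Prop :=
  [/\ orthogonal_net g U E,
      forall i, umbilical g nabla U (E i) &
      forall i, integrable_distr U (orth_distr g (E i))].

Definition span_fields {R : realType} {n : nat} {M : manifold R n}
    (X : 'I_n -> vfield M) (P : pred 'I_n) : distr M :=
  fun x => [set v | exists a : 'I_n -> R, v = \sum_(i < n | P i) a i *: X i x].

(* { span{X_i} : i < k } together with Delta (index None). *)
Definition lines_and {R : realType} {n : nat} {M : manifold R n} (k : nat)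
    (X : 'I_n -> vfield M) (Delta : distr M)
    (j : option {i : 'I_n | (i < k)%N}) : distr M :=
  if j is Some i then span_fields X (pred1 (val i)) else Delta.
Arguments lines_and {R n M} k X Delta j x.

Definition orthonormal_frame {R : realType} {n : nat} {M : manifold R n}
    (g : metric_field M) (U : set M) (X : 'I_n -> vfield M) : Prop :=
  (forall i, smooth_vf U (X i)) /\
  forall x, U x -> forall i j, g x (X i x) (X j x) = (i == j)%:R.

(* Submanifold geometry of f : M -> R^m. *)

Definition immersion {R : realType} {n m : nat} {M : manifold R n}
    (f : M -> 'rV[R]_m) : Prop :=
  smooth_fun setT f /\ forall x u, u != 0 -> dM f x u != 0.

Definition induced_metric {R : realType} {n m : nat} {M : manifold R n}
    (f : M -> 'rV[R]_m) : metric_field M :=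
  fun x u v => dotp (dM f x u) (dM f x v).

Definition isometric_immersion {R : realType} {n m : nat} {M : manifold R n}
    (g : metric_field M) (f : M -> 'rV[R]_m) : Prop :=
  immersion f /\ forall x u v, g x u v = induced_metric f x u v.

Definition normal_vec {R : realType} {n m : nat} {M : manifold R n}
    (f : M -> 'rV[R]_m) (x : M) (xi : 'rV[R]_m) : Prop :=
  forall u, dotp xi (dM f x u) = 0.

(* Orthogonal projection onto N_fM(x): with J the matrix whose rows span
   f_*T_xM, the projection is id - J^T (J J^T)^-1 J on row vectors. *)
Definition nproj {R : realType} {n m : nat} {M : manifold R n}
    (f : M -> 'rV[R]_m) (x : M) (w : 'rV[R]_m) : 'rV[R]_m :=
  let J := \matrix_(i < n) dM f x (delta_mx 0 i) in
  w - w *m J^T *m invmx (J *m J^T) *m J.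

(* alpha(u,v) is the normal part of the ambient derivative along u of f_*Y,
   for any extension Y of v; here Y has constant components in chart_at x. *)
Definition sff {R : realType} {n m : nat} {M : manifold R n}
    (f : M -> 'rV[R]_m) (x : M) (u v : 'rV[R]_n) : 'rV[R]_m :=
  let c := chart_at x in
  nproj f x ('D_u (fun y => 'D_v (f \o cinv c) y) (cmap c x)).

(* Traces and norms are taken with the inverse Gram matrix of <,>_f. *)
Definition mean_curv {R : realType} {n m : nat} {M : manifold R n}
    (f : M -> 'rV[R]_m) (x : M) : 'rV[R]_m :=
  let G := invmx (gram (induced_metric f) x) in
  n%:R^-1 *: \sum_i \sum_j G i j *: sff f x (delta_mx 0 i) (delta_mx 0 j).

Definition sff_sqnorm {R : realType} {n m : nat} {M : manifold R n}
    (f : M -> 'rV[R]_m) (x : M) : R :=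
  let G := invmx (gram (induced_metric f) x) in
  \sum_i \sum_j \sum_k \sum_l
    G i k * G j l * dotp (sff f x (delta_mx 0 i) (delta_mx 0 j))
                         (sff f x (delta_mx 0 k) (delta_mx 0 l)).

Definition umbilic_free {R : realType} {n m : nat} {M : manifold R n}
    (f : M -> 'rV[R]_m) : Prop :=
  forall x, ~ (forall u v : 'rV[R]_n,
    sff f x u v = induced_metric f x u v *: mean_curv f x).

Definition normal_field {R : realType} {n m : nat} {M : manifold R n}
    (f : M -> 'rV[R]_m) (V : set M) (xi : M -> 'rV[R]_m) : Prop :=
  smooth_fun V xi /\ forall x, V x -> normal_vec f x (xi x).

Definition nconn {R : realType} {n m : nat} {M : manifold R n}
    (f : M -> 'rV[R]_m) (X : vfield M) (xi : M -> 'rV[R]_m) : M -> 'rV[R]_m :=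
  fun x => nproj f x (vder X xi x).

Definition flat_normal_bundle {R : realType} {n m : nat} {M : manifold R n}
    (f : M -> 'rV[R]_m) : Prop :=
  forall (V : set M) (X Y : vfield M) (xi : M -> 'rV[R]_m), open V ->
    smooth_vf V X -> smooth_vf V Y -> normal_field f V xi ->
    forall x, V x ->
      nconn f X (nconn f Y xi) x - nconn f Y (nconn f X xi) x
      - nconn f (bracket X Y) xi x = 0.

Definition E_pn {R : realType} {n m : nat} {M : manifold R n}
    (f : M -> 'rV[R]_m) (eta : M -> 'rV[R]_m) : distr M :=
  fun x => [set u | forall v, sff f x u v = induced_metric f x u v *: eta x].

Definition has_dim {R : realType} {n : nat} (S : set 'rV[R]_n) (s : nat) :
    Prop :=
  exists B : 'M[R]_(s, n), row_free B /\ S = [set v : 'rV[R]_n | (v <= B)%MS].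

Definition principal_normal {R : realType} {n m : nat} {M : manifold R n}
    (f : M -> 'rV[R]_m) (x : M) (zeta : 'rV[R]_m) (s : nat) : Prop :=
  [/\ normal_vec f x zeta, (0 < s)%N & has_dim (E_pn f (fun=> zeta) x) s].

Definition principal_normal_field {R : realType} {n m : nat}
    {M : manifold R n} (f : M -> 'rV[R]_m) (eta : M -> 'rV[R]_m) (s : nat) :
    Prop :=
  normal_field f setT eta /\ forall x, principal_normal f x (eta x) s.

(* For flat normal bundle: the number of distinct principal normals is
   constant (not properness as a continuous map). *)
Definition is_proper {R : realType} {n m : nat} {M : manifold R n}
    (f : M -> 'rV[R]_m) : Prop :=
  exists k : nat, forall x,
    ([set zeta | exists s, principal_normal f x zeta s] #= `I_k)%card.

(* Moebius invariants of an umbilic-free immersion. *)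

Definition rho {R : realType} {n m : nat} {M : manifold R n}
    (f : M -> 'rV[R]_m) (x : M) : R :=
  Num.sqrt (n%:R / (n%:R - 1) *
    (sff_sqnorm f x - n%:R * dotp (mean_curv f x) (mean_curv f x))).

Definition moebius_metric {R : realType} {n m : nat} {M : manifold R n}
    (f : M -> 'rV[R]_m) : metric_field M :=
  fun x u v => rho f x ^+ 2 * induced_metric f x u v.

Definition moebius_sff {R : realType} {n m : nat} {M : manifold R n}
    (f : M -> 'rV[R]_m) (x : M) (u v : 'rV[R]_n) : 'rV[R]_m :=
  rho f x *: (sff f x u v - induced_metric f x u v *: mean_curv f x).

(* nabla is meant to be the Levi-Civita connection of moebius_metric f. *)
Definition blaschke {R : realType} {n m : nat} {M : manifold R n}
    (f : M -> 'rV[R]_m) (nabla : vfield M -> vfield M -> vfield M)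
    (X Y : vfield M) (x : M) : R :=
  let gs := moebius_metric f in
  let r := rho f x in
  let gr := grad gs (rho f) x in
  let H := mean_curv f x in
  r^-1 * dotp (moebius_sff f x (X x) (Y x)) H
  + (2 * r ^+ 2)^-1 * (gs x gr gr + dotp H H) * gs x (X x) (Y x)
  - r^-1 * hess nabla (rho f) X Y x.

Definition moebius_form {R : realType} {n m : nat} {M : manifold R n}
    (f : M -> 'rV[R]_m) (X : vfield M) : M -> 'rV[R]_m :=
  fun x => - (rho f x)^-1 *:
    (nconn f X (mean_curv f) x
     + moebius_sff f x (X x) (grad (moebius_metric f) (rho f) x)).

Definition closed_moebius_form {R : realType} {n m : nat} {M : manifold R n}
    (f : M -> 'rV[R]_m) : Prop :=
  forall (V : set M) (X Y : vfield M), open V ->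
    smooth_vf V X -> smooth_vf V Y ->
    forall x, V x ->
      nconn f X (moebius_form f Y) x - nconn f Y (moebius_form f X) x
      - moebius_form f (bracket X Y) x = 0.

Definition moebius_normal {R : realType} {n m : nat} {M : manifold R n}
    (f : M -> 'rV[R]_m) (eta : M -> 'rV[R]_m) (x : M) : 'rV[R]_m :=
  (rho f x)^-1 *: (eta x - mean_curv f x).

(* Main.v *)
(* In the frame (X_i), let f_i = X_i(f) and s = rho^-2, so f_i.f_j = s delta_ij,
   and let v_i = alpha(X_i,X_i) - s eta, which vanishes exactly for i in Delta.
   Writing the conformally flat metric in a flat chart, the Gauss equation reads
   alpha(X_i,X_i).alpha(X_j,X_j) = P_i + P_j for i <> j; since Delta contains two
   indices, this makes the v_i pairwise orthogonal.  With A_ij^k the components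
   of the derivatives X_i(f_j), the Codazzi equation for distinct i, j, k is
   A_ij^k (v_j - v_k) = A_ji^k (v_i - v_k); pairing with v_j gives A_ij^k = 0 as
   soon as j or k lies outside Delta.  For a in Delta the same equation on
   (a, j, a) shows that A_aj^a does not depend on a.  On distinct indices A
   coincides, by Koszul's formula, with the Christoffel symbols of the Moebius
   metric, and the vanishing of these is exactly the TP condition. *)

Require Import Defs.
From mathcomp Require Import all_boot all_order all_algebra.
From mathcomp Require Import all_classical all_reals all_analysis.
From mathcomp Require Import ring lra zify.
Set Implicit Arguments.
Unset Strict Implicit.
Unset Printing Implicit Defensive.
Import Order.TTheory GRing.Theory Num.Theory.
Import numFieldNormedType.Exports.
Local Open Scope classical_set_scope.
Local Open Scope ring_scope.

(** * Calculus of smooth maps between normed spaces *)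

(** The computation stays in the ambient space: only [f] and its iterated derivatives are used, so
    the Gauss and Codazzi equations come from commuting derivatives of vector-valued functions,
    without a connection for the induced metric and without the Weyl tensor.

    Two points shape the argument. The frame is orthonormal for the Moebius metric but has the
    variable squared length [s] for the induced one. Hence [A] is antisymmetric in its last two
    indices only up to a diagonal term [X_i(s) / s], and it is compared with the Christoffel symbols
    directly only on distinct indices; on [(c, c, j)] the discrepancy is [X_j(s) / (2 s)], the same
    for all [c] in Delta, so umbilicity survives. Moreover [v_j] must be nonzero for [j] outside
    Delta, since its squared norm is cancelled: this is where the exact multiplicity of [eta]
    enters, by a dimension count.

    The connection is known only through axioms on fields smooth over an open set, so its locality
    in the first argument has to be derived before a field can be expanded in the frame. *)

Lemma derive_comp {R : realType} {U V W : normedModType R} (phi : U -> V)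
    (h : V -> W) x v : differentiable phi x -> differentiable h (phi x) ->
  'D_v (h \o phi) x = 'D_('D_v phi x) h (phi x).
Proof.
move=> dphi dh; rewrite deriveE; last exact: differentiable_comp.
by rewrite diff_comp//= deriveE// deriveE.
Qed.

Section Differentiability.
Context {R : realType} {V : normedModType R}.

(** The differential of [f] serves as that of [h]: a first-order expansion sees only the germ at
    [x]. *)
Lemma near_eq_differentiable {W : normedModType R} (f h : V -> W) (x : V) :
  (\near x, f x = h x) -> differentiable f x -> differentiable h x.
Proof.
move=> fh /diff_locallyP[cf fE]; apply/diff_locallyP.
have key : h \o shift x = cst (h x) + 'd f x +o_ 0 id.
  apply/eqaddoP => _/posnumP[e].
  have hx : h x = f x by rewrite (nbhs_singleton fh).
  move/eqaddoP : fE => /(_ e%:num) /(_ [gt0 of e%:num]).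
  apply: filter_app.
  have fh0 : \forall y \near 0, f (y + x) = h (y + x).
    by move: fh; rewrite (near_shift 0 x) /=; apply: filterS => y; rewrite subr0.
  near=> y.
  have fhy : f (y + x) = h (y + x) by near: y.
  by rewrite /= -![(_ + _ : _ -> _) _]/(_ + _) -![(- _ : _ -> _) _]/(- _) /= fhy /cst hx.
have dh := diff_unique cf key.
by rewrite dh.
Unshelve. all: by end_near. Qed.

Lemma open_near (W : Type) (O : set V) (h h' : V -> W) (x : V) : open O ->
  O x -> (forall y, O y -> h y = h' y) -> \near x, h x = h' x.
Proof.
by move=> Oo Ox hh'; near=> y; apply: hh'; near: y; exact: open_nbhs_nbhs.
Unshelve. all: by end_near. Qed.

Lemma near_eq_continuous_at {W : normedModType R} (f h : V -> W) (x : V) :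
  (\near x, f x = h x) -> {for x, continuous f} -> {for x, continuous h}.
Proof.
move=> fh cf; suff : h @ x --> h x by [].
rewrite -(nbhs_singleton fh).
by apply: cvg_trans cf; apply: near_eq_cvg.
Qed.

Section Ck.
Context {W : normedModType R}.
Implicit Types (O : set V) (h : V -> W).

Lemma Ck_eq k O h h' : open O -> (forall y, O y -> h y = h' y) ->
  Ck k O h -> Ck k O h'.
Proof.
move=> Oo; elim: k h h' => [|k IH] h h' hh' /=.
  move=> ch x Ox; apply: near_eq_continuous_at (ch x Ox).
  exact: open_near hh'.
move=> [dh Dh]; split=> [x Ox|v].
  by apply: near_eq_differentiable (dh x Ox); exact: open_near hh'.
apply: IH (Dh v) => y Oy.
by apply: near_eq_derive; exact: open_near hh'.
Qed.

(** The rules for products and inverses bring undifferentiated factors into the derivative, so their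
    inductions need regularity one order lower. *)
Lemma CkS k O h : Ck k.+1 O h -> Ck k O h.
Proof.
elim: k h => [|k IH] h [dh Dh].
  by move=> x Ox; apply: differentiable_continuous; exact: dh.
by split=> // v; exact: IH.
Qed.

Lemma Ck_subset k O O' h : O' `<=` O -> Ck k O h -> Ck k O' h.
Proof.
move=> sO; elim: k h => [|k IH] h /=; first by move=> ch x /sO; exact: ch.
by move=> [dh Dh]; split=> [x /sO|v]; [exact: dh|exact: IH].
Qed.

Lemma Ck_cst k O (c : W) : Ck k O (cst c).
Proof.
elim: k c => [|k IH] c /=; first by move=> x _; exact: cst_continuous.
split=> [x _|v]; first exact: differentiable_cst.
suff -> : 'D_v (cst c) = cst 0 by exact: IH.
by apply/funext => x; rewrite derive_cst.
Qed.

Lemma Ck_add k O h h' : open O -> Ck k O h -> Ck k O h' ->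
  Ck k O (fun x => h x + h' x).
Proof.
move=> Oo; elim: k h h' => [|k IH] h h' /=.
  by move=> ch ch' x Ox; apply: continuousD; [exact: ch|exact: ch'].
move=> [dh Dh] [dh' Dh']; split=> [x Ox|v].
  by apply: differentiableD; [exact: dh|exact: dh'].
apply: (Ck_eq Oo _ (IH _ _ (Dh v) (Dh' v))) => y Oy.
by apply/esym/(@deriveD _ _ _ h h'); apply: diff_derivable; [exact: dh|exact: dh'].
Qed.

Lemma Ck_sum k O (I : Type) (r : seq I) (P : pred I) (h : I -> V -> W) :
  open O -> (forall i, P i -> Ck k O (h i)) ->
  Ck k O (fun x => \sum_(i <- r | P i) h i x).
Proof.
move=> Oo Ch; elim: r => [|i r IH].
  by apply: (Ck_eq Oo _ (@Ck_cst k O 0)) => y _; rewrite big_nil.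
case Pi : (P i).
  by apply: (Ck_eq Oo _ (Ck_add Oo (Ch i Pi) IH)) => y _; rewrite big_cons Pi.
by apply: (Ck_eq Oo _ IH) => y _; rewrite big_cons Pi.
Qed.

Lemma smooth_eq O h h' : open O -> (forall y, O y -> h y = h' y) ->
  smooth O h -> smooth O h'.
Proof. by move=> Oo hh' sh k; exact: Ck_eq hh' (sh k). Qed.

Lemma smooth_subset O O' h : O' `<=` O -> smooth O h -> smooth O' h.
Proof. by move=> sO sh k; exact: Ck_subset sO (sh k). Qed.

Lemma smooth_derive O h v : smooth O h -> smooth O ('D_v h).
Proof. by move=> sh k; have [_ Dh] := sh k.+1; exact: Dh. Qed.

Lemma smooth_diff O h x : smooth O h -> O x -> differentiable h x.
Proof. by move=> sh Ox; case: (sh 1%N) => dh _; exact: dh. Qed.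

Lemma smooth_add O h h' : open O -> smooth O h -> smooth O h' ->
  smooth O (fun x => h x + h' x).
Proof. by move=> Oo sh sh' k; exact: Ck_add. Qed.

Lemma smooth_sum O (I : Type) (r : seq I) (P : pred I) (h : I -> V -> W) :
  open O -> (forall i, P i -> smooth O (h i)) ->
  smooth O (fun x => \sum_(i <- r | P i) h i x).
Proof. by move=> Oo Ch k; apply: Ck_sum => // i Pi; exact: Ch. Qed.

End Ck.

Section CkReal.
Implicit Types (O : set V) (h : V -> R).

Lemma Ck_mul k O h h' : open O -> Ck k O h -> Ck k O h' ->
  Ck k O (fun x => h x * h' x).
Proof.
move=> Oo; elim: k h h' => [|k IH] h h'.
  by move=> ch ch' x Ox; apply: continuousM; [exact: ch|exact: ch'].
move=> Ch Ch'; have [dh Dh] := Ch; have [dh' Dh'] := Ch'; split=> [x Ox|v].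
  by apply: differentiableM; [exact: dh|exact: dh'].
apply: (Ck_eq Oo _ (Ck_add Oo (IH _ _ (CkS Ch) (Dh' v))
  (IH _ _ (CkS Ch') (Dh v)))) => y Oy.
by apply/esym/(@deriveM _ _ h h'); apply: diff_derivable; [exact: dh|exact: dh'].
Qed.

Lemma Ck_inv k O h : open O -> (forall x, O x -> h x != 0) -> Ck k O h ->
  Ck k O (fun x => (h x)^-1).
Proof.
move=> Oo h0; elim: k => [|k IH].
  by move=> ch x Ox; apply: continuousV; [exact: h0|exact: ch].
move=> Ch; have [dh Dh] := Ch; split=> [x Ox|v].
  by apply: differentiableV; [exact: dh|exact: h0].
have Ci := IH (CkS Ch).
apply: (Ck_eq Oo _ (Ck_mul Oo (@Ck_cst R k O (- 1))
  (Ck_mul Oo (Ck_mul Oo Ci Ci) (Dh v)))) => y Oy.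
rewrite (@deriveV _ _ h); [|exact: h0|by apply: diff_derivable; exact: dh].
by rewrite /cst mulN1r scaleNr /= -[_ *: _]/(_ * _) -exprVn expr2.
Qed.

Lemma smooth_mul O h h' : open O -> smooth O h -> smooth O h' ->
  smooth O (fun x => h x * h' x).
Proof. by move=> Oo sh sh' k; exact: Ck_mul. Qed.

Lemma smooth_inv O h : open O -> (forall x, O x -> h x != 0) -> smooth O h ->
  smooth O (fun x => (h x)^-1).
Proof. by move=> Oo h0 sh k; exact: Ck_inv. Qed.

End CkReal.

Section Coordinates.
Context {m : nat}.
Implicit Types (O : set V) (h : V -> 'rV[R]_m).

Lemma differentiable_rowP h x :
  differentiable h x <-> forall i, differentiable (fun y => h y 0 i) x.
Proof.
split=> [dh i|dh].
  apply: (@differentiable_comp _ _ _ _ h (fun N : 'rV[R]_m => N 0 i)) => //.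
  exact: differentiable_coord.
have -> : h = \sum_i (fun y => h y 0 i *: delta_mx 0 i).
  by apply/funext => y; rewrite fct_sumE {1}[h y]row_sum_delta.
by apply: differentiable_sum => i; apply: differentiableZl.
Qed.

Lemma derive_coord h x v i : differentiable h x ->
  'D_v h x 0 i = 'D_v (fun y => h y 0 i) x.
Proof.
by move=> dh; rewrite derive_mx ?mxE//; exact: diff_derivable.
Qed.

Lemma Ck_rowP k O h : open O ->
  Ck k O h <-> forall i, Ck k O (fun y => h y 0 i).
Proof.
move=> Oo; split; elim: k h => [|k IH] h.
- move=> ch i x Ox.
  apply: (@continuous_comp _ _ _ h (fun N : 'rV[R]_m => N 0 i)).
    exact: ch.
  exact: coord_continuous.
- move=> [dh Dh] i; split=> [x Ox|v].
    by have /differentiable_rowP := dh x Ox; apply.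
  apply: (Ck_eq Oo _ (IH _ (Dh v) i)) => y Oy.
  by rewrite derive_coord//; exact: dh.
- move=> ch.
  have hE y : O y -> \sum_i h y 0 i *: delta_mx 0 i = h y.
    by rewrite {2}[h y]row_sum_delta.
  apply: (Ck_eq Oo hE); apply: (@Ck_sum _ 0) => // i _ x Ox.
  exact: cvgZr_tmp (ch i x Ox).
- move=> Ch; have dh x : O x -> differentiable h x.
    by move=> Ox; apply/differentiable_rowP => i; case: (Ch i) => + _; apply.
  split=> // v; apply: IH => i; case: (Ch i) => _ /(_ v).
  by apply: Ck_eq => // y Oy; rewrite derive_coord//; exact: dh.
Qed.

Lemma smooth_rowP O h : open O ->
  smooth O h <-> forall i, smooth O (fun y => h y 0 i).
Proof.
move=> Oo; split=> [sh i k|sh k].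
  by have /Ck_rowP := sh k; apply.
by apply/Ck_rowP => // i; exact: sh.
Qed.

End Coordinates.

Lemma derive_dir_linear {W : normedModType R} (h : V -> W) x (a : R) u v :
  differentiable h x -> 'D_(a *: u + v) h x = a *: 'D_u h x + 'D_v h x.
Proof. by move=> dh; rewrite !deriveE// linearP. Qed.

Lemma derive_dir_sum {W : normedModType R} (h : V -> W) x (I : Type) (r : seq I)
    (P : pred I) (a : I -> R) (u : I -> V) : differentiable h x ->
  'D_(\sum_(i <- r | P i) a i *: u i) h x
    = \sum_(i <- r | P i) a i *: 'D_(u i) h x.
Proof.
move=> dh; rewrite deriveE// linear_sum; apply: eq_bigr => i _.
by rewrite linearZ deriveE.
Qed.

Lemma derive_translate {W : normedModType R} (h : V -> W) c x u :
  differentiable h (x + c) ->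
  'D_u (fun y => h (y + c)) x = 'D_u h (x + c).
Proof.
move=> dh; have dt : differentiable (fun y : V => y + c) x.
  by apply: (@differentiableD _ _ _ id (cst c)).
rewrite (@derive_comp _ _ _ _ (fun y => y + c) h)//; congr ('D_ _ h _).
by rewrite (@deriveD _ _ _ id (cst c)) ?derive_id ?derive_cst ?addr0.
Qed.

(** * Symmetry of second derivatives *)

Lemma directional_MVT (h : V -> R) y u (t : R) : 0 < t ->
  (forall s, 0 <= s <= t -> differentiable h (y + s *: u)) ->
  exists2 s, 0 <= s <= t & h (y + t *: u) - h y = t * 'D_u h (y + s *: u).
Proof.
move=> t0 dh; pose phi (s : R) : V := s *: u + y.
have dphi s : is_diff s phi ( *:%R^~ u).
  by apply: is_diff_eq; rewrite addr0.
have phiE s : phi s = y + s *: u by rewrite /phi addrC.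
pose k := h \o phi.
have dk s : 0 <= s <= t -> differentiable k s.
  by move=> st; apply: differentiable_comp => //; rewrite phiE; exact: dh.
have Dk s : 0 <= s <= t -> 'D_1 k s = 'D_u h (y + s *: u).
  move=> st; rewrite (@derive_comp _ _ _ _ phi h); [|by []|by rewrite phiE; exact: dh].
  have [dphis Ephi] := dphi s.
  by rewrite [X in 'D_X h _]deriveE// Ephi scale1r phiE.
have [||c] := @MVT R k (fun s => 'D_u h (y + s *: u)) 0 t t0.
- move=> s; rewrite in_itv/= => /andP[s0 st].
  have st' : 0 <= s <= t by rewrite !ltW.
  by rewrite -Dk//; apply: derivableP; apply: diff_derivable; exact: dk.
- apply: continuous_in_subspaceT => s; rewrite inE/= in_itv/= => st.
  by apply: differentiable_continuous; exact: dk.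
rewrite in_itv/= => /andP[c0 ct]; rewrite /k /= !phiE scale0r addr0 subr0 => E.
exists c; first by rewrite !ltW.
by rewrite E mulrC.
Qed.

(** Mean value theorem twice: along [u] for [y |-> h (y + t *: v) - h y], then along [v] for
    ['D_u h]. The left side is symmetric in [u] and [v], which makes it the tool for Schwarz's
    theorem. *)
Lemma second_difference (O : set V) (h : V -> R) x u v (t : R) : 0 < t ->
  Ck 2 O h ->
  (forall s r, 0 <= s <= t -> 0 <= r <= t -> O (x + s *: u + r *: v)) ->
  exists s r, [/\ 0 <= s <= t, 0 <= r <= t &
    h (x + t *: u + t *: v) - h (x + t *: u) - (h (x + t *: v) - h x)
      = t ^+ 2 * 'D_v ('D_u h) (x + s *: u + r *: v)].
Proof.
move=> t0 [dh /(_ u) [dDh _]] sO.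
have tt : 0 <= t <= t by rewrite ltW//=.
have t00 : (0 : R) <= 0 <= t by rewrite lexx ltW.
have sO0 s : 0 <= s <= t -> O (x + s *: u).
  by move=> /sO /(_ t00); rewrite scale0r addr0.
pose k y := h (y + t *: v) - h y.
have dk s : 0 <= s <= t -> differentiable (fun y => h (y + t *: v)) (x + s *: u).
  move=> st; apply: (@differentiable_comp _ _ _ _ (fun y => y + t *: v) h).
    by apply: (@differentiableD _ _ _ id (cst (t *: v))).
  by apply: dh; exact: sO.
have [|s st E] := @directional_MVT k x u t t0.
  by move=> s st; apply: (@differentiableB _ _ _ (fun y => h (y + t *: v)) h);
    [exact: dk|apply: dh; exact: sO0].
have [|r rt E'] := @directional_MVT ('D_u h) (x + s *: u) v t t0.
  by move=> r rt; apply: dDh; exact: sO.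
exists s, r; split=> //.
rewrite -[LHS]/(k (x + t *: u) - k x) E expr2 -mulrA -E'; congr (_ * _).
rewrite (@deriveB _ _ _ (fun y => h (y + t *: v)) h).
- by rewrite derive_translate//; apply: dh; exact: sO.
- by apply: diff_derivable; exact: dk.
- by apply: diff_derivable; apply: dh; exact: sO0.
Qed.

(** The same second difference, divided by [t ^+ 2], is a value of either mixed derivative at a
    point near [x]; continuity of both then brings their values at [x] within every [e]. *)
Lemma schwarz (O : set V) (h : V -> R) x u v : open O -> O x -> Ck 2 O h ->
  'D_u ('D_v h) x = 'D_v ('D_u h) x.
Proof.
move=> Oo Ox Ch.
apply/eqP; rewrite -subr_eq0 -normr_le0; apply/ler_addgt0Pl => e e0.
rewrite addr0.
have [dh Dh] := Ch.
have cont a b : {for x, continuous ('D_a ('D_b h))}.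
  by have [_ /(_ a)] := Dh b; apply.
have e2 : 0 < e / 2 by rewrite divr_gt0.
have Uuv : \forall y \near x, `|'D_u ('D_v h) x - 'D_u ('D_v h) y| < e / 2.
  by have /cvgrPdist_lt := cont u v; apply.
have Uvu : \forall y \near x, `|'D_v ('D_u h) x - 'D_v ('D_u h) y| < e / 2.
  by have /cvgrPdist_lt := cont v u; apply.
have UO : \forall y \near x, O y by exact: open_nbhs_nbhs.
have /nbhs_ballP[d /= d0 ball_d] : \forall y \near x, [/\ O y,
    `|'D_u ('D_v h) x - 'D_u ('D_v h) y| < e / 2 &
    `|'D_v ('D_u h) x - 'D_v ('D_u h) y| < e / 2].
  by move: Uuv Uvu UO; apply: filterS3 => y ? ? ?; split.
(* With [t * N = d / 2] the parallelogram spanned by [t *: u] and [t *: v] stays in the ball; the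
   [1] keeps [N] positive when [u] and [v] vanish. *)
pose N : R := `|u| + (`|v| + 1).
have N0 : 0 < N by apply: ltr_wpDl => //; apply: ltr_wpDl.
pose t : R := d / 2 / N.
have t0 : 0 < t by rewrite !divr_gt0.
have in_ball s r : 0 <= s <= t -> 0 <= r <= t -> ball x d (x + s *: u + r *: v).
  move=> /andP[s0 st] /andP[r0 rt]; rewrite -ball_normE /=.
  rewrite -addrA opprD addrA subrr add0r normrN.
  apply: (le_lt_trans (ler_normD _ _)); rewrite !normrZ !ger0_norm//.
  apply: (@le_lt_trans _ _ (t * N)).
    rewrite /N !mulrDr mulr1; apply: lerD; first exact: ler_wpM2r.
    by rewrite -[leLHS]addr0; apply: lerD; [exact: ler_wpM2r|exact: ltW].
  by rewrite /t divfK ?gt_eqF// ltr_pdivrMr// ltr_pMr// ltr1n.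
have sO s r : 0 <= s <= t -> 0 <= r <= t -> O (x + s *: u + r *: v).
  by move=> st rt; case: (ball_d _ (in_ball s r st rt)).
have [s [r [st rt E]]] := second_difference t0 Ch sO.
have sO' s' r' : 0 <= s' <= t -> 0 <= r' <= t -> O (x + s' *: v + r' *: u).
  by move=> st' rt'; rewrite addrAC; case: (ball_d _ (in_ball r' s' rt' st')).
have [s' [r' [st' rt' E']]] := second_difference t0 Ch sO'.
have {E'} : 'D_u ('D_v h) (x + s' *: v + r' *: u)
    = 'D_v ('D_u h) (x + s *: u + r *: v).
  apply: (@mulfI _ (t ^+ 2)); first by rewrite expf_neq0// gt_eqF.
  have swap (a b c d' : R) : a - b - (c - d') = a - c - (b - d') by ring.
  refine (etrans (esym E') (etrans _ E)).
  by rewrite [x + t *: v + _]addrAC; exact: swap.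
have -> : x + s' *: v + r' *: u = x + r' *: u + s' *: v by exact: addrAC.
move=> E'.
have [_ Buv _] := ball_d _ (in_ball r' s' rt' st').
have [_ _ Bvu] := ball_d _ (in_ball s r st rt).
have close (a b c c' : R) : c' = c -> `|a - c'| < e / 2 -> `|b - c| < e / 2 ->
    `|a - b| <= e.
  move=> -> ac bc; have -> : a - b = (a - c) - (b - c) by ring.
  by apply: (le_trans (ler_normB _ _)); rewrite [e]splitr lerD ?ltW.
exact: close E' Buv Bvu.
Qed.

End Differentiability.

(** * Chain rule and variable directions on row vectors *)

Section RowDomain.
Context {R : realType} {n : nat}.

Lemma derive_row_sum {W : normedModType R} (h : 'rV[R]_n -> W) x v :
  differentiable h x ->
  'D_v h x = \sum_i v 0 i *: 'D_(delta_mx 0 i) h x.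
Proof. by move=> dh; rewrite {1}[v]row_sum_delta derive_dir_sum. Qed.

(** For scalar [h] the chain rule is a sum of products; the induction hypothesis applies to the
    partial derivatives of [h], with [phi] kept. *)
Lemma Ck_comp {V : normedModType R} k (O : set V) (O' : set 'rV[R]_n)
    (phi : V -> 'rV[R]_n) (h : 'rV[R]_n -> R) : open O ->
  (forall x, O x -> O' (phi x)) -> Ck k O phi -> Ck k O' h ->
  Ck k O (h \o phi).
Proof.
move=> Oo OO'; elim: k h => [|k IH] h.
  move=> cphi ch x Ox; apply: continuous_comp; first exact: cphi.
  by apply: ch; exact: OO'.
move=> Cphi Ch; have [dphi Dphi] := Cphi; have [dh Dh] := Ch; split=> [x Ox|v].
  by apply: differentiable_comp; [exact: dphi|apply: dh; exact: OO'].
pose D x := \sum_i 'D_v phi x 0 i * ('D_(delta_mx 0 i) h \o phi) x.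
apply: (@Ck_eq _ _ _ k O D) => //.
  move=> y Oy; rewrite derive_comp; [|exact: dphi|by apply: dh; exact: OO'].
  by rewrite derive_row_sum//; apply: dh; exact: OO'.
apply: Ck_sum => // i _; apply: Ck_mul => //; last exact: IH (CkS Cphi) (Dh _).
by apply: (Ck_rowP k ('D_v phi) Oo).1; exact: Dphi.
Qed.

Lemma smooth_comp {V : normedModType R} {m : nat} (O : set V)
    (O' : set 'rV[R]_n) (phi : V -> 'rV[R]_n) (h : 'rV[R]_n -> 'rV[R]_m) :
  open O -> open O' ->
  (forall x, O x -> O' (phi x)) -> smooth O phi -> smooth O' h ->
  smooth O (h \o phi).
Proof.
move=> Oo O'o OO' sphi sh; apply/smooth_rowP => // i k.
apply: (@Ck_comp _ k O O' phi (fun y => h y 0 i)) => //.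
by apply: (smooth_rowP h O'o).1.
Qed.

(** Product rule for a derivative with moving direction: one term differentiates the direction [Y],
    the other the base point [phi]. Its vector form gives second derivatives along fields and the
    change of chart for [sff]. *)
Lemma derive_along {V : normedModType R} (O' : set 'rV[R]_n)
    (Y phi : V -> 'rV[R]_n) (h : 'rV[R]_n -> R) x u : open O' ->
  O' (phi x) -> smooth O' h -> differentiable phi x -> differentiable Y x ->
  'D_u (fun w => 'D_(Y w) h (phi w)) x
    = 'D_('D_u Y x) h (phi x) + 'D_('D_u phi x) ('D_(Y x) h) (phi x).
Proof.
move=> Oo Ox sh dphi dY.
have dh : differentiable h (phi x) by exact: smooth_diff sh Ox.
have dYi i : differentiable (fun w => Y w 0 i) x by exact: (differentiable_rowP Y x).1.
have dDh i : differentiable ('D_(delta_mx 0 i) h) (phi x).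
  by apply: (smooth_diff (O := O')) => //; exact: smooth_derive.
have dDhp i : differentiable ('D_(delta_mx 0 i) h \o phi) x.
  exact: differentiable_comp.
pose term i w := Y w 0 i * ('D_(delta_mx 0 i) h \o phi) w.
have E1 : 'D_u (fun w => 'D_(Y w) h (phi w)) x
    = 'D_u (fun w => \sum_i term i w) x.
  apply: near_eq_derive.
  have cphi : {for x, continuous phi} by exact: differentiable_continuous.
  have nO : \forall y \near phi x, O' y by exact: open_nbhs_nbhs.
  have nphi : \forall w \near x, O' (phi w) by exact: cphi nO.
  apply: filterS nphi => w Ow.
  by rewrite derive_row_sum//; exact: smooth_diff sh Ow.
have E2 : 'D_u (fun w => \sum_i term i w) x = \sum_i 'D_u (term i) x.
  rewrite -derive_sum; last first.
    by move=> i; apply: diff_derivable; exact: (differentiableM (dYi i) (dDhp i)).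
  by congr ('D_ _ _ _); apply/funext => w; rewrite fct_sumE.
have E3 : 'D_('D_u Y x) h (phi x)
    = \sum_i 'D_u Y x 0 i * 'D_(delta_mx 0 i) h (phi x) by exact: derive_row_sum.
pose term' i w := Y x 0 i * 'D_(delta_mx 0 i) h w.
have E4 : 'D_('D_u phi x) ('D_(Y x) h) (phi x)
    = 'D_('D_u phi x) (fun w => \sum_i term' i w) (phi x).
  apply: near_eq_derive; apply: (open_near Oo Ox) => w Ow.
  by rewrite derive_row_sum//; exact: smooth_diff sh Ow.
have E5 : 'D_('D_u phi x) (fun w => \sum_i term' i w) (phi x)
    = \sum_i Y x 0 i * 'D_('D_u phi x) ('D_(delta_mx 0 i) h) (phi x).
  transitivity (\sum_i 'D_('D_u phi x) (term' i) (phi x)).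
    rewrite -derive_sum; last first.
      by move=> i; apply: derivableZ; exact: diff_derivable.
    by congr ('D_ _ _ _); apply/funext => w; rewrite fct_sumE.
  by apply: eq_bigr => i _; apply: (@deriveZ _ _ _ ('D_(delta_mx 0 i) h));
    exact: diff_derivable.
rewrite {}E1 {}E2 {}E3 {}E4 {}E5 -big_split; apply: eq_bigr => i _ /=.
rewrite derive_coord//.
rewrite (@deriveM _ _ (fun w => Y w 0 i) ('D_(delta_mx 0 i) h \o phi));
  [|exact: diff_derivable|exact: diff_derivable].
rewrite (@derive_comp _ _ _ _ phi ('D_(delta_mx 0 i) h))//.
by rewrite addrC; congr (_ + _); rewrite -[LHS]/(_ * _) mulrC.
Qed.

Lemma derive_along_row {V : normedModType R} {m : nat} (O' : set 'rV[R]_n)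
    (Y phi : V -> 'rV[R]_n) (h : 'rV[R]_n -> 'rV[R]_m) x u : open O' ->
  O' (phi x) -> smooth O' h -> differentiable phi x -> differentiable Y x ->
  differentiable (fun w => 'D_(Y w) h (phi w)) x ->
  'D_u (fun w => 'D_(Y w) h (phi w)) x
    = 'D_('D_u Y x) h (phi x) + 'D_('D_u phi x) ('D_(Y x) h) (phi x).
Proof.
move=> Oo Ox sh dphi dY dl; apply/rowP => i.
have shi := (smooth_rowP h Oo).1 sh i.
have dh : differentiable h (phi x) by exact: smooth_diff sh Ox.
have E1 : 'D_u (fun w => 'D_(Y w) h (phi w)) x 0 i
    = 'D_u (fun w => 'D_(Y w) (fun y => h y 0 i) (phi w)) x.
  rewrite derive_coord//; apply: near_eq_derive.
  have cphi : {for x, continuous phi} by exact: differentiable_continuous.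
  have nO : \forall y \near phi x, O' y by exact: open_nbhs_nbhs.
  have nphi : \forall w \near x, O' (phi w) by exact: cphi nO.
  apply: filterS nphi => w Ow.
  by rewrite derive_coord//; exact: smooth_diff sh Ow.
have E2 : 'D_('D_u phi x) ('D_(Y x) h) (phi x) 0 i
    = 'D_('D_u phi x) ('D_(Y x) (fun y => h y 0 i)) (phi x).
  rewrite derive_coord; last by apply: smooth_diff Ox; exact: smooth_derive.
  apply: near_eq_derive; apply: (open_near Oo Ox) => w Ow.
  by rewrite derive_coord//; exact: smooth_diff sh Ow.
have add_coord (a b : 'rV[R]_m) : (a + b) 0 i = a 0 i + b 0 i by rewrite !mxE.
refine (etrans E1 (etrans (derive_along u Oo Ox shi dphi dY) _)).
refine (etrans _ (esym (add_coord _ _))).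
by refine (congr2 _ (esym _) (esym E2)); exact: derive_coord.
Qed.

Lemma schwarz_row {V : normedModType R} {m : nat} (O : set V) (h : V -> 'rV[R]_m)
    x u v : open O -> O x -> smooth O h -> 'D_u ('D_v h) x = 'D_v ('D_u h) x.
Proof.
move=> Oo Ox sh; apply/rowP => i.
have E a b : 'D_a ('D_b h) x 0 i = 'D_a ('D_b (fun y => h y 0 i)) x.
  rewrite derive_coord; last by apply: smooth_diff Ox; exact: smooth_derive.
  apply: near_eq_derive; apply: (open_near Oo Ox) => w Ow.
  by rewrite derive_coord//; exact: smooth_diff sh Ow.
refine (etrans (E _ _) (etrans _ (esym (E _ _)))).
exact: schwarz Oo Ox ((smooth_rowP h Oo).1 sh i 2%N).
Qed.

End RowDomain.

(** * Smooth functions and vector fields on a manifold *)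

Section Charts.
Context {R : realType} {n : nat} {M : manifold R n}.
Implicit Types (V : set M) (c : chart R n M) (X Y : vfield M) (x : M).

Lemma chart_imageP c V w : is_chart c -> (cmap c @` (V `&` cdom c)) w ->
  [/\ V (cinv c w), cdom c (cinv c w) & cmap c (cinv c w) = w].
Proof. by move=> [_ _ cK _ _] [x [Vx cx] <-]; rewrite cK. Qed.

Lemma open_chart_image c V : is_chart c -> open V ->
  open (cmap c @` (V `&` cdom c)).
Proof.
move=> [cdo cio cK _ cic] Vo; rewrite openE => w [x [Vx cx] <-].
have imx : (cmap c @` cdom c) (cmap c x) by exists x.
have nim : \forall z \near cmap c x, (cmap c @` cdom c) z by exact: open_nbhs_nbhs.
have nV : \forall z \near cmap c x, (V `&` cdom c) (cinv c z).
  have := cic _ imx; apply; rewrite /= cK//.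
  by apply: open_nbhs_nbhs; split => //; exact: openI.
move: nim nV; rewrite /interior /=; apply: filterS2 => z [y cy <-].
by rewrite /= cK// => -[Vy _]; exists y.
Qed.

Lemma atlas_is_chart c : atlas c -> is_chart c.
Proof. exact: atlas_chart. Qed.

Lemma chart_at_is_chart x : is_chart (chart_at x).
Proof. by apply: atlas_is_chart; exact: chart_at_atlas. Qed.

Lemma near_chart c V x : is_chart c -> open V -> V x -> cdom c x ->
  \forall w \near cmap c x, (cmap c @` (V `&` cdom c)) w.
Proof.
move=> cc Vo Vx cx; apply: open_nbhs_nbhs; split; last by exists x.
exact: open_chart_image.
Qed.

Definition diff_at {W : normedModType R} (h : M -> W) x :=
  differentiable (h \o cinv (chart_at x)) (cmap (chart_at x) x).

Lemma diff_at_chart c x : smooth_transition (chart_at x) c -> is_chart c ->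
  cdom c x -> diff_at (cmap c) x.
Proof.
move=> tr cc cx; apply: (smooth_diff tr).
by exists x => //; split=> //; exact: chart_at_dom.
Qed.

(** Chain rule through the transition from [chart_at x]. The chart [c] may belong to the maximal
    atlas only, as the charts provided by conformal flatness do. *)
Lemma dM_chart {W : normedModType R} c (h : M -> W) x u :
  smooth_transition (chart_at x) c -> is_chart c -> cdom c x ->
  differentiable (h \o cinv c) (cmap c x) ->
  dM h x u = 'D_(dM (cmap c) x u) (h \o cinv c) (cmap c x).
Proof.
move=> tr cc cx dh; rewrite /dM.
have c0K : cinv (chart_at x) (cmap (chart_at x) x) = x.
  by have [_ _ + _ _] := chart_at_is_chart x; apply; exact: chart_at_dom.
rewrite -[X in 'D_(_) (h \o cinv c) X](congr1 (cmap c) c0K).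
rewrite -(@derive_comp _ _ _ _ (cmap c \o cinv (chart_at x)) (h \o cinv c)).
- apply: near_eq_derive; have [co _ cK _ _] := cc.
  have := near_chart (chart_at_is_chart x) co cx (chart_at_dom x).
  apply: filterS => w /(chart_imageP (chart_at_is_chart x))[cw _ _] /=.
  by rewrite cK.
- exact: diff_at_chart.
- by rewrite /= c0K.
Qed.

Lemma smooth_fun_diff_at {W : normedModType R} V (h : M -> W) x :
  smooth_fun V h -> V x -> diff_at h x.
Proof.
move=> sh Vx; apply: (smooth_diff (sh _ (chart_at_atlas x))).
by exists x => //; split=> //; exact: chart_at_dom.
Qed.

Lemma dM_linear {W : normedModType R} (h : M -> W) x (a : R) u v :
  diff_at h x -> dM h x (a *: u + v) = a *: dM h x u + dM h x v.
Proof. exact: derive_dir_linear. Qed.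

Lemma dM_sum {W : normedModType R} (h : M -> W) x (I : Type) (r : seq I)
    (P : pred I) (a : I -> R) (u : I -> 'rV[R]_n) : diff_at h x ->
  dM h x (\sum_(i <- r | P i) a i *: u i)
    = \sum_(i <- r | P i) a i *: dM h x (u i).
Proof. exact: derive_dir_sum. Qed.

Lemma dM_sub {W : normedModType R} (h : M -> W) x u v :
  diff_at h x -> dM h x (u - v) = dM h x u - dM h x v.
Proof. by move=> dh; rewrite addrC -scaleN1r dM_linear// scaleN1r addrC. Qed.

Lemma dM0 {W : normedModType R} (h : M -> W) x : dM h x 0 = 0.
Proof. exact: derive0. Qed.

Lemma dM_near {W : normedModType R} V (h h' : M -> W) x u : open V -> V x ->
  (forall y, V y -> h y = h' y) -> dM h x u = dM h' x u.
Proof.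
move=> Vo Vx hh'; apply: near_eq_derive.
have := near_chart (chart_at_is_chart x) Vo Vx (chart_at_dom x).
by apply: filterS => w /(chart_imageP (chart_at_is_chart x))[Vw _ _] /=; exact: hh'.
Qed.

Lemma vder_near {W : normedModType R} V X (h h' : M -> W) x : open V -> V x ->
  (forall y, V y -> h y = h' y) -> vder X h x = vder X h' x.
Proof. exact: dM_near. Qed.

Lemma smooth_fun_eq {W : normedModType R} V (h h' : M -> W) : open V ->
  (forall y, V y -> h y = h' y) -> smooth_fun V h -> smooth_fun V h'.
Proof.
move=> Vo hh' sh c ca; have cc := atlas_is_chart ca.
apply: smooth_eq (sh c ca); first exact: open_chart_image.
by move=> w /(chart_imageP cc)[Vw _ _]; exact: hh'.
Qed.

Lemma smooth_fun_subset {W : normedModType R} V V' (h : M -> W) : V' `<=` V ->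
  smooth_fun V h -> smooth_fun V' h.
Proof.
move=> sV sh c ca; apply: smooth_subset (sh c ca).
by move=> w [x [/sV Vx cx] <-]; exists x.
Qed.

Lemma smooth_fun_cst {W : normedModType R} V (a : W) : smooth_fun V (fun=> a).
Proof. by move=> c ca k; exact: Ck_cst. Qed.

Lemma smooth_fun_add {W : normedModType R} V (h k : M -> W) : open V ->
  smooth_fun V h -> smooth_fun V k -> smooth_fun V (fun y => h y + k y).
Proof.
move=> Vo sh sk c ca; have cc := atlas_is_chart ca.
exact: (smooth_add (open_chart_image cc Vo) (sh c ca) (sk c ca)).
Qed.

Lemma smooth_fun_sum {W : normedModType R} V (I : Type) (r : seq I)
    (P : pred I) (h : I -> M -> W) : open V ->
  (forall i, P i -> smooth_fun V (h i)) ->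
  smooth_fun V (fun y => \sum_(i <- r | P i) h i y).
Proof.
move=> Vo sh c ca; have cc := atlas_is_chart ca.
apply: (@smooth_sum _ _ _ _ I r P (fun i => h i \o cinv c)).
  exact: open_chart_image.
by move=> i Pi; exact: sh.
Qed.

Lemma smooth_fun_mul V (h k : M -> R) : open V ->
  smooth_fun V h -> smooth_fun V k -> smooth_fun V (fun y => h y * k y).
Proof.
move=> Vo sh sk c ca; have cc := atlas_is_chart ca.
exact: (smooth_mul (open_chart_image cc Vo) (sh c ca) (sk c ca)).
Qed.

Lemma smooth_fun_inv V (h : M -> R) : open V ->
  (forall y, V y -> h y != 0) ->
  smooth_fun V h -> smooth_fun V (fun y => (h y)^-1).
Proof.
move=> Vo h0 sh c ca; have cc := atlas_is_chart ca.
apply: (smooth_inv (open_chart_image cc Vo) _ (sh c ca)).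
by move=> w /(chart_imageP cc)[Vw _ _]; exact: h0.
Qed.

Lemma smooth_fun_rowP {m : nat} V (h : M -> 'rV[R]_m) : open V ->
  smooth_fun V h <-> forall i, smooth_fun V (fun y => h y 0 i).
Proof.
move=> Vo; split=> [sh i c ca|sh c ca].
  have cc := atlas_is_chart ca.
  exact: ((smooth_rowP _ (open_chart_image cc Vo)).1 (sh c ca)).
have cc := atlas_is_chart ca.
by apply/(smooth_rowP _ (open_chart_image cc Vo)) => i; exact: sh.
Qed.

Lemma vder_coord {m : nat} X (h : M -> 'rV[R]_m) x i : diff_at h x ->
  vder X h x 0 i = vder X (fun y => h y 0 i) x.
Proof. exact: derive_coord. Qed.

Lemma vder_add {W : normedModType R} X (h k : M -> W) x : diff_at h x ->
  diff_at k x -> vder X (fun y => h y + k y) x = vder X h x + vder X k x.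
Proof.
move=> dh dk.
by apply: (@deriveD _ _ _ (h \o cinv (chart_at x)) (k \o cinv (chart_at x)));
  exact: diff_derivable.
Qed.

Lemma vder_cst {W : normedModType R} X (a : W) x : vder X (fun=> a) x = 0.
Proof. exact: derive_cst. Qed.

Lemma vder_mul X (h k : M -> R) x : diff_at h x -> diff_at k x ->
  vder X (fun y => h y * k y) x = h x * vder X k x + k x * vder X h x.
Proof.
move=> dh dk.
have := @deriveM _ _ (h \o cinv (chart_at x)) (k \o cinv (chart_at x))
  (cmap (chart_at x) x) (X x) (diff_derivable dh) (diff_derivable dk).
have c0K : cinv (chart_at x) (cmap (chart_at x) x) = x.
  by have [_ _ + _ _] := chart_at_is_chart x; apply; exact: chart_at_dom.
by rewrite /= c0K.
Qed.

Lemma vder_sum X (I : Type) (r : seq I) (P : pred I) (h : I -> M -> R) x :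
  (forall i, P i -> diff_at (h i) x) ->
  vder X (fun y => \sum_(i <- r | P i) h i y) x
    = \sum_(i <- r | P i) vder X (h i) x.
Proof.
move=> dh.
(* Differentiability of the partial sums has to be carried along the induction. *)
suff [] : diff_at (fun y => \sum_(i <- r | P i) h i y) x /\
  vder X (fun y => \sum_(i <- r | P i) h i y) x
    = \sum_(i <- r | P i) vder X (h i) x by [].
elim: r => [|i r [dr IH]].
  have -> : (fun y => \sum_(i <- [::] | P i) h i y) = fun=> 0.
    by apply/funext => y; rewrite big_nil.
  rewrite big_nil; split; first exact: differentiable_cst.
  exact: derive_cst.
case Pi : (P i); last first.
  rewrite big_cons Pi.
  by have -> : (fun y => \sum_(j <- i :: r | P j) h j y)
    = fun y => \sum_(j <- r | P j) h j y by apply/funext=> y; rewrite big_cons Pi.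
rewrite big_cons Pi.
have -> : (fun y => \sum_(j <- i :: r | P j) h j y)
  = fun y => h i y + \sum_(j <- r | P j) h j y.
  by apply/funext=> y; rewrite big_cons Pi.
split; first exact: (differentiableD (dh i Pi) dr).
by rewrite vder_add ?IH//; exact: dh.
Qed.

End Charts.

(** * Derivatives along vector fields and brackets *)

Section VectorFields.
Context {R : realType} {n : nat} {M : manifold R n}.
Implicit Types (V : set M) (c : chart R n M) (X Y : vfield M) (x : M).

Lemma cinvK_at x : cinv (chart_at x) (cmap (chart_at x) x) = x.
Proof. by have [_ _ + _ _] := chart_at_is_chart x; apply; exact: chart_at_dom. Qed.

Lemma smooth_vf_rep V X c : smooth_vf V X -> atlas c ->
  smooth (cmap c @` (V `&` cdom c)) (vder X (cmap c) \o cinv c).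
Proof.
move=> sX ca; apply: smooth_subset (sX c ca c ca).
by move=> w [x [Vx cx] <-]; exists x.
Qed.

(** [dM] uses the chart chosen at each point, and this choice has no regularity. Here a whole domain
    is read in the single chart [c], the form in which smoothness can be proved. *)
Lemma vder_rep {W : normedModType R} V X c (h : M -> W) w : atlas c ->
  smooth_fun V h -> (cmap c @` (V `&` cdom c)) w ->
  vder X h (cinv c w) = 'D_(vder X (cmap c) (cinv c w)) (h \o cinv c) w.
Proof.
move=> ca sh Vw; have cc := atlas_is_chart ca.
have [Vx cx wE] := chart_imageP cc Vw.
rewrite [LHS](dM_chart (c := c)) ?wE//.
- exact: atlas_smooth (chart_at_atlas _) ca.
- exact: smooth_diff (sh c ca) Vw.
Qed.

Lemma vder_rep_sum {W : normedModType R} V X c (h : M -> W) w : atlas c ->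
  smooth_fun V h -> (cmap c @` (V `&` cdom c)) w ->
  vder X h (cinv c w) =
    \sum_i vder X (cmap c) (cinv c w) 0 i *: 'D_(delta_mx 0 i) (h \o cinv c) w.
Proof.
move=> ca sh Vw; rewrite (vder_rep X ca sh Vw) derive_row_sum//.
exact: smooth_diff (sh c ca) Vw.
Qed.

Lemma smooth_vder_real V X (h : M -> R) : open V -> smooth_vf V X ->
  smooth_fun V h -> smooth_fun V (vder X h).
Proof.
move=> Vo sX sh c ca; have cc := atlas_is_chart ca.
have Oo := open_chart_image cc Vo.
apply: (smooth_eq (h := fun w => \sum_i
    vder X (cmap c) (cinv c w) 0 i * 'D_(delta_mx 0 i) (h \o cinv c) w)) => //.
  by move=> w Vw; rewrite /= (vder_rep_sum X ca sh Vw).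
apply: smooth_sum => // i _; apply: smooth_mul => //.
  by apply: (smooth_rowP _ Oo).1; exact: smooth_vf_rep.
by apply: smooth_derive; exact: sh.
Qed.

Lemma smooth_vder {m : nat} V X (h : M -> 'rV[R]_m) : open V ->
  smooth_vf V X -> smooth_fun V h -> smooth_fun V (vder X h).
Proof.
move=> Vo sX sh; apply/smooth_fun_rowP => // i.
have shi := (smooth_fun_rowP h Vo).1 sh i.
apply: smooth_fun_eq Vo _ (smooth_vder_real Vo sX shi) => y Vy.
by rewrite vder_coord//; exact: smooth_fun_diff_at sh Vy.
Qed.

Lemma smooth_fun_dotp {m : nat} V (h k : M -> 'rV[R]_m) : open V ->
  smooth_fun V h -> smooth_fun V k -> smooth_fun V (fun y => dotp (h y) (k y)).
Proof.
move=> Vo /smooth_fun_rowP-/(_ Vo) sh /smooth_fun_rowP-/(_ Vo) sk.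
by apply: smooth_fun_sum => // i _; exact: smooth_fun_mul.
Qed.

Lemma smooth_fun_scale {m : nat} V (a : M -> R) (h : M -> 'rV[R]_m) : open V ->
  smooth_fun V a -> smooth_fun V h -> smooth_fun V (fun y => a y *: h y).
Proof.
move=> Vo sa /smooth_fun_rowP-/(_ Vo) sh; apply/smooth_fun_rowP => // i.
apply: smooth_fun_eq Vo _ (smooth_fun_mul Vo sa (sh i)) => y _.
by rewrite mxE.
Qed.

Lemma vder_dotp {m : nat} V X (h k : M -> 'rV[R]_m) x : open V -> V x ->
  smooth_fun V h -> smooth_fun V k ->
  vder X (fun y => dotp (h y) (k y)) x
    = dotp (vder X h x) (k x) + dotp (h x) (vder X k x).
Proof.
move=> Vo Vx sh sk.
have dh i : diff_at (fun y => h y 0 i) x.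
  exact: smooth_fun_diff_at ((smooth_fun_rowP h Vo).1 sh i) Vx.
have dk i : diff_at (fun y => k y 0 i) x.
  exact: smooth_fun_diff_at ((smooth_fun_rowP k Vo).1 sk i) Vx.
rewrite vder_sum => [|i _]; last exact: (differentiableM (dh i) (dk i)).
rewrite -big_split/=; apply: eq_bigr => i _; rewrite vder_mul//.
rewrite !vder_coord 1?addrC 1?[k x 0 i * _]mulrC//.
- exact: smooth_fun_diff_at sk Vx.
- exact: smooth_fun_diff_at sh Vx.
Qed.

Lemma vder_scale {m : nat} V X (a : M -> R) (h : M -> 'rV[R]_m) x :
  open V -> V x -> smooth_fun V a -> smooth_fun V h ->
  vder X (fun y => a y *: h y) x = vder X a x *: h x + a x *: vder X h x.
Proof.
move=> Vo Vx sa sh; apply/rowP => i.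
have da := smooth_fun_diff_at sa Vx.
have dh := smooth_fun_diff_at ((smooth_fun_rowP h Vo).1 sh i) Vx.
rewrite vder_coord; last exact: smooth_fun_diff_at (smooth_fun_scale Vo sa sh) Vx.
rewrite !mxE (@vder_near _ _ _ _ V X _ (fun y => a y * h y 0 i))//; last first.
  by move=> y _; rewrite mxE.
rewrite vder_mul// vder_coord; last exact: smooth_fun_diff_at sh Vx.
by rewrite addrC [h x 0 i * _]mulrC.
Qed.

Lemma vder_row_sum {m : nat} V X (I : Type) (r : seq I) (P : pred I)
    (h : I -> M -> 'rV[R]_m) x : open V -> V x ->
  (forall i, P i -> smooth_fun V (h i)) ->
  vder X (fun y => \sum_(i <- r | P i) h i y) x
    = \sum_(i <- r | P i) vder X (h i) x.
Proof.
move=> Vo Vx sh; apply/rowP => j.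
rewrite vder_coord; last first.
  by apply: (smooth_fun_diff_at (V := V)) => //; exact: smooth_fun_sum.
rewrite (@vder_near _ _ _ _ V X _ (fun y => \sum_(i <- r | P i) h i y 0 j))//.
  rewrite vder_sum => [|i Pi]; last first.
    exact: smooth_fun_diff_at ((smooth_fun_rowP _ Vo).1 (sh i Pi) j) Vx.
  rewrite summxE; apply: eq_bigr => i Pi.
  by rewrite vder_coord//; exact: smooth_fun_diff_at (sh i Pi) Vx.
by move=> y _; rewrite summxE.
Qed.

Lemma vder_chart_at X x : vder X (cmap (chart_at x)) x = X x.
Proof.
set c := chart_at x; have cc : is_chart c by exact: chart_at_is_chart.
have cx : cdom c x by exact: chart_at_dom.
have Oo := open_chart_image cc openT.
rewrite /vder /dM -[RHS](@derive_id _ _ (cmap c x)).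
apply: near_eq_derive; apply: (open_near Oo); first by exists x.
by move=> w Ow'; have [_ _] := chart_imageP cc Ow'.
Qed.

(** The second derivative splits into a first derivative of [h] along a tangent vector and the
    Hessian of its chart representative. When [h] is an immersion the first part is killed by
    [nproj]; the second, being symmetric, is killed by antisymmetrization. *)
Lemma vder_vder {m : nat} V X Y (h : M -> 'rV[R]_m) x : open V -> V x ->
  smooth_vf V X -> smooth_vf V Y -> smooth_fun V h ->
  vder X (vder Y h) x = dM h x (vder X (vder Y (cmap (chart_at x))) x)
    + 'D_(X x) ('D_(Y x) (h \o cinv (chart_at x))) (cmap (chart_at x) x).
Proof.
move=> Vo Vx sX sY sh; set c := chart_at x.
have ca : atlas c by exact: chart_at_atlas.
have cc := atlas_is_chart ca; have cx : cdom c x by exact: chart_at_dom.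
have Oo := open_chart_image cc Vo.
set O := cmap c @` (V `&` cdom c); have Ow : O (cmap c x) by exists x.
pose Yc := vder Y (cmap c) \o cinv c.
have dYc : differentiable Yc (cmap c x).
  by apply: smooth_diff Ow; exact: smooth_vf_rep.
have YcE : Yc (cmap c x) = Y x by rewrite /Yc /= cinvK_at vder_chart_at.
have repE : \forall w \near cmap c x, (vder Y h \o cinv c) w
    = 'D_(Yc w) (h \o cinv c) w.
  by apply: (open_near Oo Ow) => w Ow'; exact: vder_rep sh Ow'.
have dl : differentiable (fun w => 'D_(Yc w) (h \o cinv c) w) (cmap c x).
  apply: near_eq_differentiable repE _.
  have svf := smooth_vder Vo sY sh.
  exact: smooth_diff (svf c ca) Ow.
refine (etrans (near_eq_derive _ repE) _).
refine (etrans (derive_along_row (phi := id) (X x) Oo Ow (sh c ca) _ dYc dl) _).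
  by [].
by rewrite YcE derive_id.
Qed.

(* The second-order terms cancel by symmetry of the second derivative, so only
   the derivatives of the components of the fields survive. *)
Lemma vder_bracket {m : nat} V X Y (h : M -> 'rV[R]_m) x : open V -> V x ->
  smooth_vf V X -> smooth_vf V Y -> smooth_fun V h ->
  vder X (vder Y h) x - vder Y (vder X h) x = dM h x (bracket X Y x).
Proof.
move=> Vo Vx sX sY sh.
have cc := chart_at_is_chart x; have ca := chart_at_atlas x.
have Oo := open_chart_image cc Vo.
have Ow : (cmap (chart_at x) @` (V `&` cdom (chart_at x))) (cmap (chart_at x) x).
  by exists x => //; split=> //; exact: chart_at_dom.
rewrite (vder_vder Vo Vx sX sY sh) (vder_vder Vo Vx sY sX sh).
rewrite (schwarz_row _ _ Oo Ow (sh _ ca)).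
have cancel (a b c : 'rV[R]_m) : a + c - (b + c) = a - b.
  by rewrite opprD addrACA subrr addr0.
apply: (etrans (cancel _ _ _)).
exact/esym/dM_sub/(smooth_fun_diff_at sh Vx).
Qed.

End VectorFields.

(** * Immersions and their second fundamental form *)

Section DotProduct.
Context {R : realType} {m : nat}.
Implicit Types u v w : 'rV[R]_m.

Lemma dotpE u v : dotp u v = (u *m v^T) 0 0.
Proof. by rewrite mxE; apply: eq_bigr => i _; rewrite mxE. Qed.

Lemma dotpC u v : dotp u v = dotp v u.
Proof. by apply: eq_bigr => i _; rewrite mulrC. Qed.

Lemma dotp_linear (a : R) u v w : dotp (a *: u + v) w = a * dotp u w + dotp v w.
Proof. by rewrite !dotpE mulmxDl -scalemxAl !mxE. Qed.

Lemma dotpDl u v w : dotp (u + v) w = dotp u w + dotp v w.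
Proof. by rewrite !dotpE mulmxDl mxE. Qed.

Lemma dotpZl a u w : dotp (a *: u) w = a * dotp u w.
Proof. by rewrite !dotpE -scalemxAl mxE. Qed.

Lemma dotpNl u w : dotp (- u) w = - dotp u w.
Proof. by rewrite !dotpE mulNmx mxE. Qed.

Lemma dotpBl u v w : dotp (u - v) w = dotp u w - dotp v w.
Proof. by rewrite dotpDl dotpNl. Qed.

Lemma dotp0l w : dotp 0 w = 0.
Proof. by rewrite dotpE mul0mx mxE. Qed.

Lemma dotp_suml (I : Type) (r : seq I) (P : pred I) (F : I -> 'rV[R]_m) w :
  dotp (\sum_(i <- r | P i) F i) w = \sum_(i <- r | P i) dotp (F i) w.
Proof. by rewrite dotpE mulmx_suml summxE; under [RHS]eq_bigr do rewrite dotpE. Qed.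

Lemma dotpDr u v w : dotp w (u + v) = dotp w u + dotp w v.
Proof. by rewrite !(dotpC w) dotpDl. Qed.

Lemma dotpZr a u w : dotp w (a *: u) = a * dotp w u.
Proof. by rewrite !(dotpC w) dotpZl. Qed.

Lemma dotpBr u v w : dotp w (u - v) = dotp w u - dotp w v.
Proof. by rewrite !(dotpC w) dotpBl. Qed.

Lemma dotp0r w : dotp w 0 = 0.
Proof. by rewrite dotpC dotp0l. Qed.

Lemma dotp_sumr (I : Type) (r : seq I) (P : pred I) (F : I -> 'rV[R]_m) w :
  dotp w (\sum_(i <- r | P i) F i) = \sum_(i <- r | P i) dotp w (F i).
Proof. by rewrite dotpC dotp_suml; under eq_bigr do rewrite dotpC. Qed.

Lemma dotp_ge0 u : 0 <= dotp u u.
Proof. by apply: sumr_ge0 => i _; rewrite -expr2 sqr_ge0. Qed.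

Lemma dotp_eq0 u : dotp u u = 0 -> u = 0.
Proof.
move=> /eqP; rewrite psumr_eq0 => [/allP u0|i _]; last by rewrite -expr2 sqr_ge0.
apply/rowP => i; have /implyP/(_ isT) := u0 i (mem_index_enum i).
by rewrite mulf_eq0 orbb => /eqP ->; rewrite mxE.
Qed.

Lemma dotp_gt0 u : u != 0 -> 0 < dotp u u.
Proof.
by rewrite lt0r dotp_ge0 andbT; apply: contra => /eqP /dotp_eq0 ->.
Qed.

End DotProduct.

Section SmoothFields.
Context {R : realType} {n : nat} {M : manifold R n}.
Implicit Types (V : set M) (X Y : vfield M).

Lemma smooth_vf_subset V V' X : V' `<=` V -> smooth_vf V X -> smooth_vf V' X.
Proof.
by move=> sV sX c ca; apply: smooth_fun_subset (sX c ca) => x [/sV].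
Qed.

Lemma smooth_vf_eq V X Y : open V -> (forall x, V x -> X x = Y x) ->
  smooth_vf V X -> smooth_vf V Y.
Proof.
move=> Vo XY sX c ca; have [cdo _ _ _ _] := atlas_is_chart ca.
apply: smooth_fun_eq (sX c ca); first exact: openI.
by move=> y [Vy _]; rewrite /vder XY.
Qed.

Lemma smooth_vf_sum V (I : Type) (r : seq I) (P : pred I) (a : I -> M -> R)
    (X : I -> vfield M) : open V ->
  (forall i, P i -> smooth_fun V (a i)) -> (forall i, P i -> smooth_vf V (X i)) ->
  smooth_vf V (fun x => \sum_(i <- r | P i) a i x *: X i x).
Proof.
move=> Vo sa sX c ca; have cc := atlas_is_chart ca; have [cdo _ _ _ _] := cc.
have VIo : open (V `&` cdom c) by exact: openI.
apply: (@smooth_fun_eq _ _ _ _ _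
  (fun y => \sum_(i <- r | P i) a i y *: vder (X i) (cmap c) y)) => //.
  move=> y [Vy cy]; rewrite [RHS]dM_sum//.
  by apply: diff_at_chart => //; exact: atlas_smooth (chart_at_atlas _) ca.
apply: smooth_fun_sum => // i Pi; apply: smooth_fun_scale => //; last exact: sX.
by apply: smooth_fun_subset (sa i Pi) => y [].
Qed.

Lemma smooth_vf_add V X Y : open V -> smooth_vf V X -> smooth_vf V Y ->
  smooth_vf V (fun x => X x + Y x).
Proof.
move=> Vo sX sY c ca; have cc := atlas_is_chart ca; have [cdo _ _ _ _] := cc.
have VIo : open (V `&` cdom c) by exact: openI.
apply: smooth_fun_eq VIo _ (smooth_fun_add VIo (sX c ca) (sY c ca)) => y [Vy cy].
have dc : diff_at (cmap c) y.
  by apply: diff_at_chart => //; exact: atlas_smooth (chart_at_atlas _) ca.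
by have := dM_linear 1 (X y) (Y y) dc; rewrite !scale1r.
Qed.

Lemma smooth_vf_zero V X : open V -> (forall x, V x -> X x = 0) -> smooth_vf V X.
Proof.
move=> Vo X0.
(* The zero field is an empty combination. *)
apply: (@smooth_vf_eq V (fun x => \sum_(i <- [::] : seq 'I_0) 0 *: 0)) => //.
  by move=> x Vx; rewrite big_nil X0.
by apply: smooth_vf_sum => // -[].
Qed.

End SmoothFields.

Section Immersion.
Context {R : realType} {n m : nat} {M : manifold R n}.
Variable f : M -> 'rV[R]_m.
Hypothesis f_imm : immersion f.
Implicit Types (V : set M) (X Y : vfield M) (x : M).

Let f_smooth V : smooth_fun V f.
Proof. by apply: smooth_fun_subset f_imm.1. Qed.

Definition immJ x := \matrix_(i < n) dM f x (delta_mx 0 i).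

Lemma diff_at_imm x : diff_at f x.
Proof. exact: smooth_fun_diff_at (f_smooth setT) _. Qed.

Lemma dM_immE x u : dM f x u = u *m immJ x.
Proof.
rewrite /dM derive_row_sum; last exact: diff_at_imm.
by rewrite mulmx_sum_row; apply: eq_bigr => i _; rewrite rowK.
Qed.

(** For [u] in the kernel, [u J J^T u^T] is the squared norm of [dM f x u], and the differential of
    an immersion kills no nonzero vector. *)
Lemma immJ_gram_unit x : immJ x *m (immJ x)^T \in unitmx.
Proof.
rewrite -row_free_unit -kermx_eq0; apply/eqP/row_matrixP => i; rewrite row0.
set u := row i _; apply/eqP/negPn/negP => u0.
have /eqP := f_imm.2 x u u0; apply; rewrite dM_immE; apply: dotp_eq0.
have : u *m (immJ x *m (immJ x)^T) = 0.
  by rewrite /u -row_mul mulmx_ker row0.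
by rewrite dotpE trmx_mul !mulmxA => ->; rewrite mul0mx mxE.
Qed.

Lemma nprojE x w : nproj f x w = w - w *m (immJ x)^T
  *m invmx (immJ x *m (immJ x)^T) *m immJ x.
Proof. by []. Qed.

Lemma nproj_linear x a u v :
  nproj f x (a *: u + v) = a *: nproj f x u + nproj f x v.
Proof.
rewrite !nprojE !mulmxDl -!scalemxAl scalerBr opprD.
by rewrite -!addrA; congr (_ + _); rewrite addrCA.
Qed.

Lemma nprojD x u v : nproj f x (u + v) = nproj f x u + nproj f x v.
Proof. by rewrite -[u in LHS]scale1r nproj_linear scale1r. Qed.

Lemma nproj_tangent x u : nproj f x (dM f x u) = 0.
Proof.
rewrite nprojE dM_immE -(mulmxA u (immJ x)) -(mulmxA u (_ *m _)) mulmxV ?immJ_gram_unit//.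
by rewrite mulmx1 subrr.
Qed.

Lemma nproj_normal x w : normal_vec f x (nproj f x w).
Proof.
move=> u; rewrite dotpE dM_immE trmx_mul mulmxA.
rewrite nprojE mulmxBl -!mulmxA mulVmx ?immJ_gram_unit//.
by rewrite !mulmxA mulmx1 subrr mul0mx mxE.
Qed.

Lemma nproj_decomp x w : exists u, w = nproj f x w + dM f x u.
Proof.
exists (w *m (immJ x)^T *m invmx (immJ x *m (immJ x)^T)).
by rewrite dM_immE nprojE subrK.
Qed.

(** The tangent part of [xi] is orthogonal to [xi] and to its normal part, hence to itself. *)
Lemma nproj_id x xi : normal_vec f x xi -> nproj f x xi = xi.
Proof.
move=> nxi; have [u E] := nproj_decomp x xi.
suff u0 : dM f x u = 0 by rewrite {2}E u0 addr0.
apply: dotp_eq0; have : dotp xi (dM f x u) = 0 by exact: nxi.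
by rewrite {1}E dotpDl nproj_normal add0r.
Qed.

Lemma dotp_nproj x xi w : normal_vec f x xi -> dotp xi (nproj f x w) = dotp xi w.
Proof.
move=> nxi; have [u {2}->] := nproj_decomp x w.
by rewrite dotpDr nxi addr0.
Qed.

(** Differentiating the components of [Y] yields a tangent vector, killed by [nproj]; so the
    constant extension in the definition of [sff] can be traded for any smooth field. *)
Lemma sff_vder V X Y x : open V -> V x -> smooth_vf V X -> smooth_vf V Y ->
  nproj f x (vder X (vder Y f) x) = sff f x (X x) (Y x).
Proof.
move=> Vo Vx sX sY; rewrite (vder_vder Vo Vx sX sY (f_smooth V)).
by rewrite nprojD nproj_tangent add0r.
Qed.

Let F x := f \o cinv (chart_at x).

Lemma smooth_imm_rep x : smooth (cmap (chart_at x) @` cdom (chart_at x)) (F x).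
Proof.
rewrite -[cdom _]setTI; exact: f_imm.1 (chart_at_atlas x).
Qed.

Let imm_dom_open x : open (cmap (chart_at x) @` cdom (chart_at x)).
Proof. by have [_ + _ _ _] := chart_at_is_chart x. Qed.

Let imm_dom_in x : (cmap (chart_at x) @` cdom (chart_at x)) (cmap (chart_at x) x).
Proof. by exists x => //; exact: chart_at_dom. Qed.

Lemma sff_linearl x a u v w :
  sff f x (a *: u + v) w = a *: sff f x u w + sff f x v w.
Proof.
rewrite /sff derive_dir_linear ?nproj_linear//.
apply: (smooth_diff _ (imm_dom_in x)); apply: smooth_derive.
exact: smooth_imm_rep.
Qed.

Lemma sff_sym x u v : sff f x u v = sff f x v u.
Proof.
have E : 'D_u ('D_v (F x)) (cmap (chart_at x) x)
    = 'D_v ('D_u (F x)) (cmap (chart_at x) x).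
  have sF := smooth_imm_rep x; have Oo := @imm_dom_open x.
  exact: schwarz_row Oo (imm_dom_in x) sF.
rewrite /sff; exact: (congr1 (nproj f x) E).
Qed.

Lemma sff_normal x u v : normal_vec f x (sff f x u v).
Proof. exact: nproj_normal. Qed.

End Immersion.

(** * Conformally flat metrics and the Gauss equation *)

Lemma derive_dotp {R : realType} {V : normedModType R} {m : nat}
    (h k : V -> 'rV[R]_m) x a : differentiable h x -> differentiable k x ->
  'D_a (fun z => dotp (h z) (k z)) x
    = dotp ('D_a h x) (k x) + dotp (h x) ('D_a k x).
Proof.
move=> dh dk.
have dhi i := (differentiable_rowP h x).1 dh i.
have dki i := (differentiable_rowP k x).1 dk i.
pose term i z := h z 0 i * k z 0 i.
transitivity (\sum_i 'D_a (term i) x).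
  rewrite -derive_sum; last first.
    by move=> i; apply: diff_derivable; exact: (differentiableM (dhi i) (dki i)).
  by congr ('D_ _ _ _); apply/funext => w; rewrite fct_sumE.
rewrite -big_split/=; apply: eq_bigr => i _.
rewrite (@deriveM _ _ (fun w => h w 0 i) (fun w => k w 0 i));
  [|exact: diff_derivable|exact: diff_derivable].
rewrite !derive_coord// addrC; congr (_ + _).
by rewrite -[LHS]/(_ * _) mulrC.
Qed.

Lemma smooth_dotp {R : realType} {V : normedModType R} {m : nat} (O : set V)
    (h k : V -> 'rV[R]_m) : open O -> smooth O h -> smooth O k ->
  smooth O (fun z => dotp (h z) (k z)).
Proof.
move=> Oo sh sk; apply: smooth_sum => // i _.
by apply: smooth_mul => //; apply: (smooth_rowP _ Oo).1.
Qed.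

Lemma sum_delta {R : realType} {n : nat} (i : 'I_n) (F : 'I_n -> R) :
  \sum_k (i == k)%:R * F k = F i.
Proof.
rewrite (bigD1 i)//= eqxx mul1r big1 ?addr0// => k ki.
by rewrite eq_sym (negPf ki) mul0r.
Qed.

(** [Q] stands for the Christoffel symbols of the first kind of commuting fields with products
    [delta_jk g], and [L] for the derivatives of [g]. The three cyclic permutations of the
    compatibility relation are combined with one sign reversed. *)
Lemma koszul_formula {R : realType} {n : nat} (Q : 'I_n -> 'I_n -> 'I_n -> R)
    (L : 'I_n -> R) : (forall i j k, Q i j k = Q j i k) ->
  (forall i j k, Q i j k + Q i k j = (j == k)%:R * L i) ->
  forall i j k, Q i j k
    = ((j == k)%:R * L i + (i == k)%:R * L j - (i == j)%:R * L k) / 2.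
Proof.
move=> Qs QL i j k.
have := QL i j k; have := QL j k i; have := QL k i j.
rewrite (Qs k i j) (Qs k j i) (Qs j i k) [k == i]eq_sym.
move: (_ * L i) (_ * L j) (_ * L k) => x y z; lra.
Qed.

(* Pointwise algebra of a metric [f1 i . f1 j = g delta_ij] with [g] the
   conformal factor: [f2], [f3] are the second and third derivatives of the
   immersion, [L1], [L2] the first and second derivatives of [g].  The sectional
   curvatures split as [P i + P j], which is the vanishing of the Weyl tensor. *)
Lemma conformal_curvature_splits {R : realType} {n m : nat}
    (f1 : 'I_n -> 'rV[R]_m) (f2 : 'I_n -> 'I_n -> 'rV[R]_m)
    (f3 : 'I_n -> 'I_n -> 'I_n -> 'rV[R]_m) (g : R) (L1 : 'I_n -> R)
    (L2 : 'I_n -> 'I_n -> R) : g != 0 ->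
  (forall i j, dotp (f1 i) (f1 j) = (i == j)%:R * g) ->
  (forall i j, f2 i j = f2 j i) ->
  (forall i j k, f3 i j k = f3 i k j) -> (forall i j k, f3 i j k = f3 j i k) ->
  (forall i j k, dotp (f2 i j) (f1 k) + dotp (f1 j) (f2 i k)
    = (j == k)%:R * L1 i) ->
  (forall a b c d, dotp (f3 a b c) (f1 d) + dotp (f2 b c) (f2 a d)
    + (dotp (f2 a c) (f2 b d) + dotp (f1 c) (f3 a b d)) = (c == d)%:R * L2 a b) ->
  let t i j := f2 i j - \sum_k (dotp (f2 i j) (f1 k) / g) *: f1 k in
  exists P : 'I_n -> R, forall i j, i != j ->
    dotp (t i i) (t j j) - dotp (t i j) (t i j) = P i + P j.
Proof.
move=> g0 f1g f2s f3s f3s' H1 H2 t.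
pose Q i j k := dotp (f2 i j) (f1 k).
have QE : forall i j k, Q i j k
    = ((j == k)%:R * L1 i + (i == k)%:R * L1 j - (i == j)%:R * L1 k) / 2.
  apply: koszul_formula => i j k; first by rewrite /Q f2s.
  by rewrite /Q [dotp (f2 i k) _]dotpC H1.
(* As [t] has no component along the [f1 k], one of the two factors can be replaced by [f2]. *)
have f2t i j a b : dotp (t i j) (t a b)
    = dotp (f2 i j) (f2 a b) - (\sum_k Q i j k * Q a b k) / g.
  have tf k : dotp (t a b) (f1 k) = 0.
    rewrite dotpBl dotp_suml.
    under eq_bigr do rewrite dotpZl f1g eq_sym mulrCA.
    by rewrite sum_delta divfK// subrr.
  have tE c d : t c d = f2 c d - \sum_k (dotp (f2 c d) (f1 k) / g) *: f1 k by [].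
  rewrite (tE i j) dotpBl dotp_suml big1 ?subr0 => [|k _]; last first.
    by rewrite dotpZl (dotpC (f1 k)) tf mulr0.
  rewrite tE dotpBr dotp_sumr; congr (_ - _); rewrite mulr_suml.
  by apply: eq_bigr => k _; rewrite dotpZr /Q mulrC mulrA.
pose S := \sum_k L1 k ^+ 2.
(* [3 / 4] is the [1 / 2] from [E2] plus the [1 / 4] from [E3]; the term [S / 4] of [E2], common to
   all pairs, is shared equally between [i] and [j]. *)
exists (fun i => - L2 i i / 2 + 3 / 4 * L1 i ^+ 2 / g - S / 8 / g) => i j ij.
(* As in Gauss's theorem, the third derivatives cancel in
   [H2 i i j j + H2 j j i i - 2 H2 i j i j]. *)
have E1 : dotp (f2 i i) (f2 j j) - dotp (f2 i j) (f2 i j)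
    = - (L2 i i + L2 j j) / 2.
  have := H2 i i j j; have := H2 j j i i; have := H2 i j i j.
  rewrite !eqxx (negPf ij) !mul1r mul0r.
  rewrite (f3s i j i) (f3s' i j j) (f3s j i j) (f2s j i).
  rewrite [dotp (f1 j) (f3 i i j)]dotpC [dotp (f1 i) (f3 j j i)]dotpC.
  move: (dotp (f3 i i j) _) (dotp (f3 j j i) _).
  move: (dotp (f2 i j) (f2 i j)) (dotp (f2 i i) (f2 j j)).
  move=> a b c d; lra.
have E2 : \sum_k Q i i k * Q j j k = - (L1 i ^+ 2 + L1 j ^+ 2) / 2 + S / 4.
  (* The generic term is [L1 k ^+ 2 / 4]; the Kronecker symbols correct the sign at the two
     exceptional indices [k = i] and [k = j]. *)
  transitivity (\sum_k ((i == k)%:R * (- (L1 i * L1 k) / 2)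
      + (j == k)%:R * (- (L1 j * L1 k) / 2) + L1 k ^+ 2 / 4)).
    apply: eq_bigr => k _; rewrite !QE !eqxx.
    have [ik|ik] := eqVneq i k; have [jk|jk] := eqVneq j k => /=.
    - by rewrite ik jk eqxx in ij.
    - by rewrite -ik; field.
    - by rewrite -jk; field.
    - by field.
  rewrite !big_split/= !sum_delta -mulr_suml -/S; by field.
have E3 : \sum_k Q i j k * Q i j k = (L1 i ^+ 2 + L1 j ^+ 2) / 4.
  transitivity (\sum_k ((i == k)%:R * (L1 j ^+ 2 / 4)
      + (j == k)%:R * (L1 i ^+ 2 / 4))).
    apply: eq_bigr => k _; rewrite !QE (negPf ij).
    have [ik|ik] := eqVneq i k; have [jk|jk] := eqVneq j k => /=.
    - by rewrite ik jk eqxx in ij.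
    - by field.
    - by field.
    - by field.
  rewrite !big_split/= !sum_delta; by field.
rewrite !f2t E2 E3.
have -> : dotp (f2 i i) (f2 j j) = dotp (f2 i j) (f2 i j) - (L2 i i + L2 j j) / 2.
  by move: E1; move: (dotp _ _) (dotp _ _) => a b; lra.
by field.
Qed.

(** * The Gauss equation in a flat chart *)

Section ConformalGauss.
Context {R : realType} {n m : nat}.
Variables (F : 'rV[R]_n -> 'rV[R]_m) (O : set 'rV[R]_n) (u : 'I_n -> 'rV[R]_n).
Variable i0 : 'I_n.
Hypotheses (Oo : open O) (sF : smooth O F).
Let F1 i := 'D_(u i) F.
Let F2 i j := 'D_(u i) (F1 j).
Let F3 i j k := 'D_(u i) (F2 j k).
(** The conformal factor is read off [F] itself, through an arbitrary index, so that its smoothness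
    follows from that of [F]. *)
Let G z := dotp (F1 i0 z) (F1 i0 z).
Hypothesis F1_orth : forall z, O z -> forall i j,
  dotp (F1 i z) (F1 j z) = (i == j)%:R * G z.

Let sF1 i : smooth O (F1 i). Proof. exact: smooth_derive. Qed.
Let sF2 i j : smooth O (F2 i j). Proof. exact: smooth_derive. Qed.
Let sG : smooth O G. Proof. exact: smooth_dotp. Qed.

Let F2_sym i j z : O z -> F2 i j z = F2 j i z.
Proof. by move=> Oz; exact: schwarz_row Oo Oz sF. Qed.

Let F1_deriv i j k z : O z ->
  dotp (F2 i j z) (F1 k z) + dotp (F1 j z) (F2 i k z)
    = (j == k)%:R * 'D_(u i) G z.
Proof.
move=> Oz; rewrite -derive_dotp; [|exact: smooth_diff (sF1 _) Oz..].
rewrite -[RHS](@deriveZ _ _ _ G); last exact/diff_derivable/(smooth_diff sG Oz).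
apply: near_eq_derive; apply: (open_near Oo Oz) => y Oy.
exact: F1_orth.
Qed.

Let F2_deriv a b c d z : O z ->
  dotp (F3 a b c z) (F1 d z) + dotp (F2 b c z) (F2 a d z)
    + (dotp (F2 a c z) (F2 b d z) + dotp (F1 c z) (F3 a b d z))
  = (c == d)%:R * 'D_(u a) ('D_(u b) G) z.
Proof.
move=> Oz.
have d1 e := smooth_diff (@sF1 e) Oz; have d2 e e' := smooth_diff (@sF2 e e') Oz.
pose p y := dotp (F2 b c y) (F1 d y); pose q y := dotp (F1 c y) (F2 b d y).
have dp : derivable p z (u a).
  by apply: diff_derivable; apply: smooth_diff Oz; exact: smooth_dotp.
have dq : derivable q z (u a).
  by apply: diff_derivable; apply: smooth_diff Oz; exact: smooth_dotp.
have Ep : 'D_(u a) p z = dotp (F3 a b c z) (F1 d z) + dotp (F2 b c z) (F2 a d z).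
  exact: (derive_dotp (u a) (d2 b c) (d1 d)).
have Eq : 'D_(u a) q z = dotp (F2 a c z) (F2 b d z) + dotp (F1 c z) (F3 a b d z).
  exact: (derive_dotp (u a) (d1 c) (d2 b d)).
refine (etrans (congr2 +%R (esym Ep) (esym Eq)) _).
refine (etrans (esym (deriveD dp dq)) _).
have dDG : derivable ('D_(u b) G) z (u a).
  by apply/diff_derivable/(smooth_diff _ Oz); exact: smooth_derive.
refine (etrans _ (deriveZ (c == d)%:R dDG)).
by apply: near_eq_derive; apply: (open_near Oo Oz) => y Oy; exact: F1_deriv.
Qed.

Lemma conformal_gauss z : O z -> G z != 0 ->
  let t i j := F2 i j z - \sum_k (dotp (F2 i j z) (F1 k z) / G z) *: F1 k z in
  exists P : 'I_n -> R, forall i j, i != j ->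
    dotp (t i i) (t j j) - dotp (t i j) (t i j) = P i + P j.
Proof.
move=> Oz Gz.
have f3s i j k : F3 i j k z = F3 i k j z.
  by apply: near_eq_derive; apply: (open_near Oo Oz) => y; exact: F2_sym.
have f3s' i j k : F3 i j k z = F3 j i k z by exact: schwarz_row Oo Oz (sF1 k).
exact: (@conformal_curvature_splits _ _ _ (fun i => F1 i z) (fun i j => F2 i j z)
  (fun i j k => F3 i j k z) (G z) (fun i => 'D_(u i) G z)
  (fun i j => 'D_(u i) ('D_(u j) G) z) Gz (F1_orth Oz)
  (fun i j => F2_sym i j Oz) f3s f3s' (fun i j k => F1_deriv i j k Oz)
  (fun a b c d => F2_deriv a b c d Oz)).
Qed.

End ConformalGauss.

(** * Linear algebra of an orthogonal frame at a point *)

Section OrthogonalFrame.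
Context {R : realType} {n m : nat} {M : manifold R n}.
Variable f : M -> 'rV[R]_m.
Hypothesis f_imm : immersion f.
Variables (x : M) (e : 'I_n -> 'rV[R]_n) (s : R).
Hypothesis s0 : s != 0.
Hypothesis e_orth : forall i j, dotp (dM f x (e i)) (dM f x (e j)) = (i == j)%:R * s.

Let dM_lin_sum (a : 'I_n -> R) (P : pred 'I_n) (u : 'I_n -> 'rV[R]_n) :
  dM f x (\sum_(i | P i) a i *: u i) = \sum_(i | P i) a i *: dM f x (u i).
Proof. by apply: dM_sum; exact: diff_at_imm. Qed.

Lemma frame_unit : \matrix_(i < n) e i \in unitmx.
Proof.
rewrite -row_free_unit -kermx_eq0; apply/eqP/row_matrixP => i; rewrite row0.
set a := row i _.
have : a *m \matrix_(i < n) e i = 0 by rewrite /a -row_mul mulmx_ker row0.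
rewrite mulmx_sum_row; under eq_bigr do rewrite rowK.
move=> /(congr1 (dM f x)); rewrite dM_lin_sum dM0 => a0.
apply/rowP => j; rewrite [RHS]mxE.
have := congr1 (dotp (dM f x (e j))) a0.
rewrite dotp0r dotp_sumr; under eq_bigr do rewrite dotpZr e_orth mulrCA.
by rewrite sum_delta => /eqP; rewrite mulf_eq0 (negPf s0) orbF => /eqP.
Qed.

Lemma frame_expand v :
  v = \sum_i (dotp (dM f x v) (dM f x (e i)) / s) *: e i.
Proof.
have [a ->] : exists a : 'rV[R]_n, v = \sum_i a 0 i *: e i.
  exists (v *m invmx (\matrix_(i < n) e i)).
  rewrite -{1}(mulmxKV frame_unit v) mulmx_sum_row.
  by apply: eq_bigr => i _; rewrite rowK.
apply: eq_bigr => i _; congr (_ *: _).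
rewrite dM_lin_sum dotp_suml.
under eq_bigr do rewrite dotpZl e_orth eq_sym mulrCA.
by rewrite sum_delta mulfK.
Qed.

(** An orthogonal frame of common squared length [s] turns the inverse Gram matrix of [nproj] into a
    division by [s]. *)
Lemma nproj_frame w : nproj f x w =
  w - \sum_i (dotp w (dM f x (e i)) / s) *: dM f x (e i).
Proof.
have [v ->] := nproj_decomp f_imm x w.
rewrite nprojD// nproj_tangent// addr0.
set p := nproj f x w.
have np u : dotp p (dM f x u) = 0 by exact: nproj_normal.
rewrite (nproj_id f_imm np).
under eq_bigr do rewrite dotpDl np add0r.
by rewrite -dM_lin_sum -frame_expand addrK.
Qed.

End OrthogonalFrame.

(** * Passage from a conformally flat chart to the manifold *)

Section ConformallyFlat.
Context {R : realType} {n m : nat} {M : manifold R n}.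
Variable f : M -> 'rV[R]_m.
Hypothesis f_imm : immersion f.

(** A preimage of [a] is the derivative along [a] of the inverse transition. *)
Lemma dM_cmap_surj (c : chart R n M) y a : smooth_chart c -> cdom c y ->
  exists v, dM (cmap c) y v = a.
Proof.
move=> [cc ctr] cy; set c' := chart_at y.
have c'c : is_chart c' by exact: chart_at_is_chart.
have c'y : cdom c' y by exact: chart_at_dom.
have [cdo _ cK _ _] := cc; have [c'do _ c'K _ _] := c'c.
have [tr tr'] := ctr c' (chart_at_atlas y).
exists ('D_a (cmap c' \o cinv c) (cmap c y)); rewrite /dM -/c'.
have E : (cmap c' \o cinv c) (cmap c y) = cmap c' y by rewrite /= cK.
have dpsi : differentiable (cmap c' \o cinv c) (cmap c y).
  by apply: (smooth_diff tr); exists y.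
have dphi : differentiable (cmap c \o cinv c') (cmap c' y).
  by apply: (smooth_diff tr'); exists y.
have := @derive_comp _ _ _ _ (cmap c' \o cinv c) (cmap c \o cinv c') (cmap c y) a dpsi.
rewrite E => /(_ dphi) <-.
rewrite -[RHS](@derive_id _ _ (cmap c y)); apply: near_eq_derive.
have := near_chart cc c'do c'y cy.
by apply: filterS => w /(chart_imageP cc)[c'w cw wE] /=; rewrite c'K.
Qed.

(** The vectors [e i] are extended by constant fields of the flat chart. These commute, and since
    the metric is there a multiple of the Euclidean one, they remain orthogonal with a common length
    near [x]; this is the situation of [conformal_gauss]. *)
Lemma conformally_flat_sff (g : metric_field M) (x : M) (e : 'I_n -> 'rV[R]_n)
    (s : R) : conformally_flat g ->
  (forall y u v, g y u v = induced_metric f y u v) -> s != 0 ->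
  (forall i j, dotp (dM f x (e i)) (dM f x (e j)) = (i == j)%:R * s) ->
  exists P : 'I_n -> R, forall i j, i != j ->
    dotp (sff f x (e i) (e i)) (sff f x (e j) (e j))
    - dotp (sff f x (e i) (e j)) (sff f x (e i) (e j)) = P i + P j.
Proof.
move=> gflat gE s0 e_orth.
(* Naming the conformal factor takes one index; in dimension 0 the claim is vacuous. *)
have [[i0 _]|noi] := pselect (exists i : 'I_n, True); last first.
  by exists (fun=> 0) => i; case: noi; exists i.
have [c [lam [sc cx slam lam0 gc]]] := gflat x.
have [cc ctr] := sc; set c0 := chart_at x.
have c0c : is_chart c0 by exact: chart_at_is_chart.
have c0x : cdom c0 x by exact: chart_at_dom.
have [cdo cio cK _ _] := cc; have [c0do c0io c0K _ _] := c0c.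
have [tr tr'] := ctr c0 (chart_at_atlas x).
have [F FE] : exists F, F = f \o cinv c by eexists.
pose phi := cmap c \o cinv c0.
pose psi := cmap c0 \o cinv c.
set O := cmap c @` (cdom c0 `&` cdom c).
set O0 := cmap c0 @` (cdom c `&` cdom c0).
have Oo : open O by exact: open_chart_image.
have O0o : open O0 by exact: open_chart_image.
have Ox : O (cmap c x) by exists x.
have O0x : O0 (cmap c0 x) by exists x.
have sphi : smooth O0 phi.
  by apply: smooth_subset tr' => w [y [? ?] <-]; exists y.
have spsi : smooth O psi.
  by apply: smooth_subset tr => w [y [? ?] <-]; exists y.
have sf0 : smooth (cmap c0 @` cdom c0) (f \o cinv c0).
  rewrite -[cdom c0]setTI; exact: f_imm.1 (chart_at_atlas x).
have sF : smooth O F.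
  apply: (@smooth_eq _ _ _ _ ((f \o cinv c0) \o psi)) => //.
    by move=> w /(chart_imageP cc)[c0w _ _]; rewrite /psi FE /= c0K.
  apply: smooth_comp spsi sf0 => // w /(chart_imageP cc)[c0w _ _].
  by exists (cinv c w).
have dMF y v : cdom c0 y -> cdom c y ->
    dM f y v = 'D_(dM (cmap c) y v) F (cmap c y).
  move=> c0y cy; have [_ trc] := ctr _ (chart_at_atlas y).
  have dF : differentiable F (cmap c y) by apply: (smooth_diff sF); exists y.
  by move: dF; rewrite FE; exact: dM_chart.
have metric y a b : cdom c0 y -> cdom c y ->
    dotp ('D_a F (cmap c y)) ('D_b F (cmap c y)) = lam y * dotp a b.
  move=> c0y cy.
  have [v va] := dM_cmap_surj a sc cy; have [w wb] := dM_cmap_surj b sc cy.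
  rewrite -va -wb -(gc y v w cy) gE.
  exact: (congr2 dotp (esym (dMF y v c0y cy)) (esym (dMF y w c0y cy))).
have [u uE0] : exists u : 'I_n -> 'rV[R]_n, forall i, dM (cmap c) x (e i) = u i.
  by eexists.
have uE i : 'D_(u i) F (cmap c x) = dM f x (e i) by rewrite -uE0 -dMF.
have lx0 : lam x != 0 by rewrite gt_eqF// lam0.
have u_orth i j : dotp (u i) (u j) = (i == j)%:R * (s / lam x).
  apply: (mulfI lx0); refine (etrans (esym (metric x _ _ c0x cx)) _).
  by rewrite !uE e_orth mulrCA [lam x * _]mulrC divfK.
have F1_orth z : O z -> forall i j, dotp ('D_(u i) F z) ('D_(u j) F z)
    = (i == j)%:R * dotp ('D_(u i0) F z) ('D_(u i0) F z).
  move=> [y [c0y cy] <-] i j.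
  have mE k l : dotp ('D_(u k) F (cmap c y)) ('D_(u l) F (cmap c y))
      = lam y * ((k == l)%:R * (s / lam x)).
    by refine (etrans (metric y _ _ c0y cy) _); rewrite u_orth.
  refine (etrans (mE _ _) (etrans _ (congr1 _ (esym (mE _ _))))).
  by rewrite eqxx mul1r mulrCA.
have G0 : dotp ('D_(u i0) F (cmap c x)) ('D_(u i0) F (cmap c x)) = s.
  by rewrite !uE e_orth eqxx mul1r.
have [P HP] := @conformal_gauss R n m F O u i0 Oo sF F1_orth (cmap c x) Ox
  (eq_ind_r (fun t => t != 0) s0 G0).
have tangent a : nproj f x ('D_a F (cmap c x)) = 0.
  have [v <-] := dM_cmap_surj a sc cx.
  by rewrite -dMF// nproj_tangent.
have phix : phi (cmap c0 x) = cmap c x by rewrite /phi /= c0K.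
have dphi w : O0 w -> differentiable phi w by move=> Ow; exact: smooth_diff sphi Ow.
have f0E w : O0 w -> (F \o phi) w = (f \o cinv c0) w.
  by move=> /(chart_imageP c0c)[cw _ _]; rewrite /phi FE /= cK.
have Ophi w : O0 w -> O (phi w).
  by move=> /(chart_imageP c0c)[cw c0w _]; exists (cinv c0 w).
have df0E j w : O0 w -> 'D_(e j) (f \o cinv c0) w = 'D_('D_(e j) phi w) F (phi w).
  move=> Ow; rewrite -(derive_comp (e j) (dphi w Ow)); last first.
    exact: smooth_diff sF (Ophi w Ow).
  by apply/esym/near_eq_derive; exact: open_near f0E.
(* The second derivatives in the two charts differ by a first derivative of [F], which is
   tangent. *)
have sffE i j : sff f x (e i) (e j)
    = nproj f x ('D_(u i) ('D_(u j) F) (cmap c x)).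
  pose Y := 'D_(e j) phi.
  have dY : differentiable Y (cmap c0 x).
    by apply: smooth_diff O0x; exact: smooth_derive.
  have dL : differentiable (fun w => 'D_(Y w) F (phi w)) (cmap c0 x).
    apply: (near_eq_differentiable (f := 'D_(e j) (f \o cinv c0))).
      by apply: (open_near O0o O0x) => w; exact: df0E.
    apply: (smooth_diff (O := O0)) => //; apply: smooth_derive.
    by apply: smooth_subset sf0 => w [y [_ c0y] <-]; exists y.
  have Ophix : O (phi (cmap c0 x)) by exact: Ophi.
  have E : 'D_(e i) ('D_(e j) (f \o cinv c0)) (cmap c0 x)
      = 'D_(e i) (fun w => 'D_(Y w) F (phi w)) (cmap c0 x).
    by apply: near_eq_derive; apply: (open_near O0o O0x) => w; exact: df0E.
  have := derive_along_row (e i) Oo Ophix sF (dphi _ O0x) dY dL.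
  rewrite phix [Y _]uE0 ['D_(e i) phi _]uE0 => E'.
  refine (etrans (congr1 (nproj f x) (etrans E E')) _).
  by rewrite nprojD tangent add0r.
have tE i j : sff f x (e i) (e j) = 'D_(u i) ('D_(u j) F) (cmap c x)
    - \sum_k (dotp ('D_(u i) ('D_(u j) F) (cmap c x)) ('D_(u k) F (cmap c x))
       / dotp ('D_(u i0) F (cmap c x)) ('D_(u i0) F (cmap c x)))
       *: 'D_(u k) F (cmap c x).
  rewrite sffE (nproj_frame f_imm s0 e_orth) G0; congr (_ - _).
  by apply: eq_bigr => k _; rewrite uE.
exists P => i j ij; rewrite !tE; exact: HP.
Qed.

End ConformallyFlat.

(** * The Codazzi equation in an orthogonal frame *)

Section Codazzi.
Context {R : realType} {n m : nat} {M : manifold R n}.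
Variables (f : M -> 'rV[R]_m) (U : set M) (X : 'I_n -> vfield M) (s : M -> R).
Hypothesis f_imm : immersion f.
Hypothesis Uo : open U.
Hypothesis sX : forall i, smooth_vf U (X i).
Hypothesis s_smooth : smooth_fun U s.
Hypothesis s0 : forall y, U y -> s y != 0.
Hypothesis X_orth : forall y, U y -> forall i j,
  dotp (dM f y (X i y)) (dM f y (X j y)) = (i == j)%:R * s y.
Hypothesis sff_diag : forall y, U y -> forall i j, i != j ->
  sff f y (X i y) (X j y) = 0.

(* Locked: comparing distinct iterated derivatives by unfolding is intractable. *)
Definition frame1 := locked (fun i => vder (X i) f).
Definition frame2 := locked (fun i j => vder (X i) (frame1 j)).
Definition frame_coef := locked (fun i j k y =>
  dotp (frame2 i j y) (frame1 k y) / s y).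
Definition frame_normal := locked (fun i j y =>
  frame2 i j y - \sum_k frame_coef i j k y *: frame1 k y).

Lemma frame1E i : frame1 i = vder (X i) f.
Proof. by rewrite /frame1 -lock. Qed.

Lemma frame2E i j : vder (X i) (frame1 j) = frame2 i j.
Proof. by rewrite /frame2 -lock. Qed.

Lemma frame_coefE i j k y :
  frame_coef i j k y = dotp (frame2 i j y) (frame1 k y) / s y.
Proof. by rewrite /frame_coef -lock. Qed.

Lemma frame_normal_def i j y :
  frame_normal i j y = frame2 i j y - \sum_k frame_coef i j k y *: frame1 k y.
Proof. by rewrite /frame_normal -lock. Qed.

Local Notation f1 := frame1.
Local Notation f2 := frame2.
Local Notation A := frame_coef.
Local Notation N := frame_normal.

Let sf : smooth_fun U f.
Proof. by apply: smooth_fun_subset f_imm.1. Qed.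

Lemma smooth_frame1 i : smooth_fun U (f1 i).
Proof. by rewrite frame1E; exact: smooth_vder. Qed.

Lemma smooth_frame2 i j : smooth_fun U (f2 i j).
Proof. by rewrite -frame2E; exact: smooth_vder (smooth_frame1 j). Qed.

Lemma smooth_frame_coef i j k : smooth_fun U (A i j k).
Proof.
apply: (smooth_fun_eq Uo (fun y _ => esym (frame_coefE i j k y))).
apply: smooth_fun_mul => //; last exact: smooth_fun_inv.
by apply: smooth_fun_dotp => //; [exact: smooth_frame2|exact: smooth_frame1].
Qed.

Let sAf i j k : smooth_fun U (fun y => A i j k y *: f1 k y).
Proof.
by apply: smooth_fun_scale => //; [exact: smooth_frame_coef|exact: smooth_frame1].
Qed.

Lemma smooth_frame_normal i j : smooth_fun U (N i j).
Proof.
have sS : smooth_fun U (fun y => \sum_k A i j k y *: f1 k y).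
  by apply: smooth_fun_sum => // k _; exact: sAf.
have sm1 : smooth_fun U (fun _ : M => - 1 : R) by exact: smooth_fun_cst.
apply: smooth_fun_eq (smooth_fun_add Uo (smooth_frame2 i j)
  (smooth_fun_scale Uo sm1 sS)) => // y _.
by rewrite frame_normal_def scaleN1r.
Qed.

Lemma frame_normalE i j y : U y -> N i j y = sff f y (X i y) (X j y).
Proof.
move=> Uy; rewrite -(sff_vder f_imm Uo Uy (sX i) (sX j)).
rewrite (nproj_frame f_imm (s0 Uy) (X_orth Uy)) frame_normal_def.
rewrite -frame2E frame1E; congr (_ - _); apply: eq_bigr => k _.
by rewrite frame_coefE -frame2E !frame1E.
Qed.

Lemma frame_bracket i j y : U y ->
  f2 i j y - f2 j i y = dM f y (bracket (X i) (X j) y).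
Proof.
by move=> Uy; rewrite -!frame2E !frame1E; exact: vder_bracket Uo Uy (sX i) (sX j) sf.
Qed.

Let dotp_frame1 i j y : U y -> dotp (f1 i y) (f1 j y) = (i == j)%:R * s y.
Proof. by move=> Uy; rewrite !frame1E; exact: X_orth. Qed.

Let frame1_expand y v : U y ->
  v = \sum_i (dotp (dM f y v) (f1 i y) / s y) *: X i y.
Proof.
move=> Uy; under eq_bigr do rewrite frame1E.
exact: (frame_expand (e := fun i => X i y) f_imm (s0 Uy) (X_orth Uy) v).
Qed.

Let nproj_frame2 i j y : U y -> nproj f y (f2 i j y) = sff f y (X i y) (X j y).
Proof. by move=> Uy; rewrite -frame2E frame1E -(sff_vder f_imm Uo Uy (sX i) (sX j)). Qed.

Let frame1_tangent i y xi : normal_vec f y xi -> dotp (f1 i y) xi = 0.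
Proof. by move=> nxi; rewrite frame1E dotpC; exact: nxi. Qed.

Lemma frame_normal_eq0 i j y : U y -> i != j -> N i j y = 0.
Proof. by move=> Uy ij; rewrite frame_normalE// sff_diag. Qed.

Lemma frame2_deriv i j k y : U y ->
  dotp (f2 i j y) (f1 k y) + dotp (f1 j y) (f2 i k y)
    = (j == k)%:R * vder (X i) s y.
Proof.
move=> Uy.
rewrite -!frame2E -(vder_dotp (X i) Uo Uy (smooth_frame1 j) (smooth_frame1 k)).
rewrite (@vder_near _ _ _ _ U (X i) _ (fun z => (j == k)%:R * s z))//.
  have sc : smooth_fun U (fun _ : M => (j == k)%:R : R) by exact: smooth_fun_cst.
  rewrite vder_mul; [|exact: smooth_fun_diff_at sc Uy
                     |exact: smooth_fun_diff_at s_smooth Uy].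
  by rewrite vder_cst mulr0 addr0.
by move=> z Uz; exact: dotp_frame1.
Qed.

(** Derivative of [f1 j . f1 k = delta_jk s]: antisymmetry fails exactly because the common length
    of the frame varies. *)
Lemma frame_coef_deriv i j k y : U y ->
  A i j k y + A i k j y = (j == k)%:R * (vder (X i) s y / s y).
Proof.
by move=> Uy; rewrite !frame_coefE -mulrDl (dotpC (f2 i k y)) frame2_deriv// mulrA.
Qed.

Lemma frame_bracket_expand i j y : U y ->
  bracket (X i) (X j) y = \sum_k (A i j k y - A j i k y) *: X k y.
Proof.
move=> Uy; refine (etrans (frame1_expand _ Uy) _); apply: eq_bigr => k _.
by rewrite -(frame_bracket i j Uy) dotpBl mulrBl !frame_coefE.
Qed.

Let dotp_frame2 i j y xi : U y -> normal_vec f y xi ->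
  dotp (f2 i j y) xi = (i == j)%:R * dotp (sff f y (X i y) (X i y)) xi.
Proof.
move=> Uy nxi; rewrite dotpC -(dotp_nproj f_imm _ nxi).
rewrite nproj_frame2// dotpC.
by have [<-|ij] := eqVneq i j; rewrite ?mul1r// sff_diag// mul0r dotp0l.
Qed.

(** Differentiating the tangential part of [f2 j k] leaves, against a normal vector, only the terms
    [A j k l * f2 i l]; as the second fundamental form is diagonal, [l = i] alone survives. *)
Let vder_frame2 i j k y xi : U y -> normal_vec f y xi ->
  dotp (vder (X i) (f2 j k) y) xi = dotp (vder (X i) (N j k) y) xi
    + A j k i y * dotp (sff f y (X i y) (X i y)) xi.
Proof.
move=> Uy nxi.
have sS : smooth_fun U (fun y => \sum_l A j k l y *: f1 l y).
  by apply: smooth_fun_sum => // l _; exact: sAf.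
have E : vder (X i) (f2 j k) y
    = vder (X i) (N j k) y + vder (X i) (fun y => \sum_l A j k l y *: f1 l y) y.
  rewrite -vder_add; [|exact: smooth_fun_diff_at (smooth_frame_normal j k) Uy
                      |exact: smooth_fun_diff_at sS Uy].
  by apply: (vder_near (X i) Uo Uy) => z _; rewrite frame_normal_def subrK.
have E' : vder (X i) (fun y => \sum_l A j k l y *: f1 l y) y
    = \sum_l vder (X i) (fun y => A j k l y *: f1 l y) y.
  apply: (@vder_row_sum _ _ _ _ U (X i) _ _ _ (fun l y => A j k l y *: f1 l y)
    y Uo Uy) => l _.
  exact: sAf.
rewrite {}E {}E' dotpDl; congr (_ + _); rewrite dotp_suml.
transitivity (\sum_l (i == l)%:R
    * (A j k l y * dotp (sff f y (X i y) (X i y)) xi)); last by rewrite sum_delta.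
apply: eq_bigr => l _.
rewrite (vder_scale (X i) Uo Uy (smooth_frame_coef j k l) (smooth_frame1 l)).
rewrite frame2E dotpDl !dotpZl frame1_tangent// dotp_frame2//.
by rewrite mulr0 add0r mulrCA.
Qed.

(** The bracket acts as a commutator on the vector function [f1 k], and the resulting identity is
    paired with a normal vector. Since [xi] is a vector at the single point [y], no extension of it
    gets differentiated. *)
Lemma codazzi i j k y xi : U y -> normal_vec f y xi ->
  let a l := dotp (sff f y (X l y) (X l y)) xi in
  dotp (vder (X i) (N j k) y) xi + A j k i y * a i
    - (dotp (vder (X j) (N i k) y) xi + A i k j y * a j)
  = (A i j k y - A j i k y) * a k.
Proof.
move=> Uy nxi a.
have E1 := vder_frame2 i j k Uy nxi; have E2 := vder_frame2 j i k Uy nxi.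
have EB : vder (X i) (f2 j k) y - vder (X j) (f2 i k) y
    = dM (f1 k) y (bracket (X i) (X j) y).
  by rewrite -!frame2E; exact: vder_bracket Uo Uy (sX i) (sX j) (smooth_frame1 k).
refine (etrans (congr2 (fun p q => p - q) (esym E1) (esym E2)) _).
refine (etrans (esym (dotpBl _ _ _)) (etrans (congr1 (dotp^~ xi) EB) _)).
have dk : diff_at (f1 k) y by exact: smooth_fun_diff_at (smooth_frame1 k) Uy.
have dE l : dM (f1 k) y (X l y) = f2 l k y by rewrite -frame2E.
rewrite (frame_bracket_expand i j Uy) (dM_sum _ _ _ _ dk) dotp_suml.
transitivity (\sum_l (k == l)%:R * ((A i j l y - A j i l y) * a l)).
  apply: eq_bigr => l _; rewrite dE dotpZl.
  refine (etrans (congr1 _ (dotp_frame2 l k Uy nxi)) _).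
  by rewrite eq_sym; exact: mulrCA.
by rewrite sum_delta.
Qed.

Let vder_normal0 i j k y : U y -> j != k -> vder (X i) (N j k) y = 0.
Proof.
move=> Uy jk; rewrite (@vder_near _ _ _ _ U _ _ (fun=> 0))//.
  exact: vder_cst.
by move=> z Uz; exact: frame_normal_eq0.
Qed.

(** [N j k] and [N i k] vanish on all of [U], hence so do their derivatives; antisymmetry of [A] on
    distinct indices then leaves only [A i j k] and [A j i k]. *)
Lemma codazzi_distinct i j k y xi : U y -> normal_vec f y xi ->
  i != j -> j != k -> i != k ->
  let a l := dotp (sff f y (X l y) (X l y)) xi in
  A i j k y * (a j - a k) = A j i k y * (a i - a k).
Proof.
move=> Uy nxi ij jk ik a.
have C : dotp (vder (X i) (N j k) y) xi + A j k i y * a i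
    - (dotp (vder (X j) (N i k) y) xi + A i k j y * a j)
  = (A i j k y - A j i k y) * a k by exact: codazzi.
clearbody a; move: C; rewrite !vder_normal0// dotp0l.
have := frame_coef_deriv i j k Uy; have := frame_coef_deriv j i k Uy.
rewrite (negPf ik) (negPf jk) !mul0r.
move: (A i j k y) (A i k j y) (A j i k y) (A j k i y) => p p' q q' E E'.
have -> : p' = - p by lra.
have -> : q' = - q by lra.
lra.
Qed.

(** Codazzi for the indices [(b, j, b)], where [A j b b] is half of [X_j(s) / s]. The right side
    involves [b] only through [N b b] and [a b], which will agree for all [b] in Delta. *)
Lemma codazzi_diag b j y xi : U y -> normal_vec f y xi -> j != b ->
  let a l := dotp (sff f y (X l y) (X l y)) xi in
  A b j b y * (a j - a b)
    = dotp (vder (X j) (N b b) y) xi - vder (X j) s y / s y * a b.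
Proof.
move=> Uy nxi jb a.
have C : dotp (vder (X b) (N j b) y) xi + A j b b y * a b
    - (dotp (vder (X j) (N b b) y) xi + A b b j y * a j)
  = (A b j b y - A j b b y) * a b by exact: codazzi.
clearbody a; move: C; rewrite vder_normal0// dotp0l.
have := frame_coef_deriv b j b Uy; have := frame_coef_deriv j b b Uy.
rewrite (negPf jb) eqxx mul0r mul1r.
move: (A b j b y) (A b b j y) (A j b b y) (dotp (vder _ _ _) _) (_ / _).
move=> p p' q d t E E'; have -> : p' = - p by lra.
have -> : q = t / 2 by lra.
lra.
Qed.

End Codazzi.

(** * Nets spanned by an orthonormal frame *)

Section FrameConnection.
Context {R : realType} {n : nat} {M : manifold R n}.
Variables (g : metric_field M) (nabla : vfield M -> vfield M -> vfield M).
Variables (U : set M) (X : 'I_n -> vfield M).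
Hypothesis g_lin : forall x a u v w, g x (a *: u + v) w = a * g x u w + g x v w.
Hypothesis g_sym : forall x u v, g x u v = g x v u.
(** Asked below [U] only: for the Moebius metric, smoothness is deduced from the frame, which lives
    on [U]. *)
Hypothesis g_smooth : forall (V : set M) (T S : vfield M), open V -> V `<=` U ->
  smooth_vf V T -> smooth_vf V S -> smooth_fun V (fun x => g x (T x) (S x)).
Hypothesis g_lc : levi_civita g nabla.
Hypothesis Uo : open U.
Hypothesis X_frame : orthonormal_frame g U X.
Hypothesis X_expand : forall x, U x -> forall v,
  v = \sum_i g x v (X i x) *: X i x.

Lemma metric0l x w : g x 0 w = 0.
Proof.
by have := g_lin x (- 1) 0 0 w; rewrite scaler0 addr0 mulN1r => ->; rewrite addNr.
Qed.

Lemma metric_suml x (I : Type) (r : seq I) (P : pred I) (a : I -> R)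
    (u : I -> 'rV[R]_n) w :
  g x (\sum_(i <- r | P i) a i *: u i) w = \sum_(i <- r | P i) a i * g x (u i) w.
Proof.
elim/big_rec2: _ => [|i y v Pi IH]; last by rewrite g_lin IH.
exact: metric0l.
Qed.

Lemma metric_sumr x (I : Type) (r : seq I) (P : pred I) (a : I -> R)
    (u : I -> 'rV[R]_n) w :
  g x w (\sum_(i <- r | P i) a i *: u i) = \sum_(i <- r | P i) a i * g x w (u i).
Proof. by rewrite g_sym metric_suml; apply: eq_bigr => i _; rewrite g_sym. Qed.

Lemma metric0r x w : g x w 0 = 0. Proof. by rewrite g_sym metric0l. Qed.

Lemma metric_subl x u v w : g x (u - v) w = g x u w - g x v w.
Proof. by rewrite addrC -scaleN1r g_lin mulN1r addrC. Qed.

Let X_orth x i j : U x -> g x (X i x) (X j x) = (i == j)%:R.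
Proof. by move=> Ux; exact: X_frame.2. Qed.

Let sX V i : V `<=` U -> smooth_vf V (X i).
Proof. by move=> VU; apply: smooth_vf_subset VU (X_frame.1 i). Qed.

Let UU : U `<=` U. Proof. by []. Qed.

(* Locality of a connection without bump functions: with [h = 0] on [V] and
   [h = 1] outside, [Z = h *: Z] globally, and [h] is smooth on [V]. *)
Lemma nabla_zero V (Z Y : vfield M) x : open V -> V x ->
  (forall y, V y -> Z y = 0) -> smooth_vf V Y -> nabla Z Y x = 0.
Proof.
move=> Vo Vx Z0 sY.
have sZ : smooth_vf V Z by exact: smooth_vf_zero.
have s0 : smooth_vf V (fun=> 0 : 'rV[R]_n) by exact: smooth_vf_zero.
have s1 : smooth_fun V (fun _ : M => 1 : R) by exact: smooth_fun_cst.
have N0 : nabla (fun=> 0) Y x = 0.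
  have E : nabla (fun=> 0) Y x = 1 *: nabla (fun=> 0) Y x + nabla (fun=> 0) Y x.
    have [_ /(_ x Vx) [<- _ _ _ _]] := g_lc Vo s0 sY s0 s1.
    by congr (nabla _ Y x); apply/funext => y; rewrite scaler0 addr0.
  by move: E => /eqP; rewrite scale1r eq_sym -subr_eq0 addrK => /eqP.
pose h (y : M) : R := if pselect (V y) then 0 else 1.
have h0 y : V y -> h y = 0 by rewrite /h; case: pselect.
have sh : smooth_fun V h.
  by apply: smooth_fun_eq Vo _ (smooth_fun_cst V 0) => y Vy; rewrite h0.
have -> : nabla Z Y x = h x *: nabla Z Y x + nabla (fun=> 0) Y x.
  have [_ /(_ x Vx) [<- _ _ _ _]] := g_lc Vo sZ sY s0 sh.
  congr (nabla _ Y x); apply/funext => y; rewrite addr0 /h.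
  by case: pselect => Vy; rewrite ?scale1r// scale0r Z0.
by rewrite N0 h0// scale0r addr0.
Qed.

(** The axioms apply to fields given on all of [M], whereas the frame expansion is guaranteed only
    below [U]. So [T] is written globally as the frame sum plus a remainder [Z] that vanishes on
    [V]; the induction keeps [Z] as last summand, to match the shape [h *: X + Z] of the axiom. *)
Lemma nabla_expand V (T Y : vfield M) x : open V -> V `<=` U -> V x ->
  smooth_vf V T -> smooth_vf V Y ->
  nabla T Y x = \sum_i g x (T x) (X i x) *: nabla (X i) Y x.
Proof.
move=> Vo VU Vx sT sY; pose t i y := g y (T y) (X i y).
have st i : smooth_fun V (t i) by exact: g_smooth Vo VU sT (sX i VU).
have sum_nabla (r : seq 'I_n) (Z : vfield M) : smooth_vf V Z ->
    nabla (fun y => \sum_(i <- r) t i y *: X i y + Z y) Y x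
      = \sum_(i <- r) t i x *: nabla (X i) Y x + nabla Z Y x.
  move=> sZ; elim: r => [|i r IH].
    rewrite big_nil add0r; congr (nabla _ Y x); apply/funext => y.
    by rewrite big_nil add0r.
  pose W y := \sum_(j <- r) t j y *: X j y + Z y.
  have sW : smooth_vf V W.
    apply: (smooth_vf_add Vo _ sZ).
    exact: (@smooth_vf_sum _ _ _ V 'I_n r predT t X Vo (fun j _ => st j)
      (fun j _ => sX j VU)).
  have [_ /(_ x Vx) [E _ _ _ _]] := g_lc Vo (sX i VU) sY sW (st i).
  rewrite big_cons -addrA -IH -E; congr (nabla _ Y x); apply/funext => y.
  by rewrite big_cons addrA.
pose S y := \sum_i t i y *: X i y.
pose Z y := T y - S y.
have Z0 y : V y -> Z y = 0.
  by move=> Vy; rewrite /Z {1}(X_expand (VU _ Vy) (T y)) subrr.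
have := sum_nabla (index_enum 'I_n) Z (smooth_vf_zero Vo Z0).
rewrite (nabla_zero Vo Vx Z0 sY) addr0 => <-; congr (nabla _ Y x).
by apply/funext => y; rewrite /Z addrC subrK.
Qed.

Definition christoffel i j k x := g x (nabla (X i) (X j) x) (X k x).
Local Notation G := christoffel.

Lemma smooth_christoffel i j k : smooth_fun U (G i j k).
Proof.
apply: (g_smooth Uo UU _ (sX k UU)).
have s0 : smooth_fun U (fun _ : M => 0 : R) by exact: smooth_fun_cst.
by have [] := g_lc Uo (sX i UU) (sX j UU)
  (sX k UU) s0.
Qed.

Lemma christoffel_antisym i j k x : U x -> G i j k x = - G i k j x.
Proof.
move=> Ux; apply/eqP; rewrite -addr_eq0; apply/eqP.
have s0 : smooth_fun U (fun _ : M => 0 : R) by exact: smooth_fun_cst.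
have [_ /(_ x Ux) [_ _ _ _ E]] := g_lc Uo (sX i UU)
  (sX j UU) (sX k UU) s0.
rewrite /G [g x (nabla (X i) (X k) x) _]g_sym -E.
refine (etrans (vder_near (h' := fun=> (j == k)%:R : R) (X i) Uo Ux _) _).
  by move=> y Uy; exact: X_orth.
exact: vder_cst.
Qed.

Lemma christoffel_torsion i j k x : U x ->
  G i j k x - G j i k x = g x (bracket (X i) (X j) x) (X k x).
Proof.
move=> Ux; have s0 : smooth_fun U (fun _ : M => 0 : R) by exact: smooth_fun_cst.
have [_ /(_ x Ux) [_ _ _ E _]] := g_lc Uo (sX i UU)
  (sX j UU) (sX k UU) s0.
by rewrite -E metric_subl.
Qed.

(* Since [S] is orthogonal to [X k], so is the derivative moved onto [X k]:
   no derivative of the components of [S] appears. *)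
Lemma nabla_christoffel V (T S : vfield M) k x : open V -> V `<=` U -> V x ->
  smooth_vf V T -> smooth_vf V S -> (forall y, V y -> g y (S y) (X k y) = 0) ->
  g x (nabla T S x) (X k x)
    = \sum_i \sum_j g x (T x) (X i x) * g x (S x) (X j x) * G i j k x.
Proof.
move=> Vo VU Vx sT sS Sk.
have s0 : smooth_fun V (fun _ : M => 0 : R) by exact: smooth_fun_cst.
have [_ /(_ x Vx) [_ _ _ _ E]] := g_lc Vo sT sS (sX k VU) s0.
have E0 : vder T (fun y => g y (S y) (X k y)) x = 0.
  by rewrite (vder_near (h' := fun=> 0 : R) T Vo Vx Sk) vder_cst.
move: E; rewrite E0 => /eqP; rewrite eq_sym addr_eq0 => /eqP ->.
rewrite (nabla_expand Vo VU Vx sT (sX k VU)) metric_sumr -sumrN.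
apply: eq_bigr => i _.
rewrite {1}(X_expand (VU _ Vx) (S x)) metric_suml mulr_sumr -sumrN.
apply: eq_bigr => j _.
by rewrite (christoffel_antisym i j k (VU _ Vx)) /G [g x (X j x) _]g_sym mulrN mulrA.
Qed.

Lemma span_fieldsP (P : pred 'I_n) x v : U x ->
  span_fields X P x v <-> forall k, ~~ P k -> g x v (X k x) = 0.
Proof.
move=> Ux; split=> [[a ->] k Pk|v0].
  rewrite metric_suml big1// => i Pi; rewrite X_orth//.
  by case: eqVneq => [ik|_]; [move: Pk; rewrite -ik Pi|rewrite mulr0].
exists (fun i => g x v (X i x)); rewrite {1}(X_expand Ux v) [RHS]big_mkcond.
by apply: eq_bigr => i _; case: ifPn => // /v0 ->; rewrite scale0r.
Qed.

Lemma orth_span_fields (P : pred 'I_n) x : U x ->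
  orth_distr g (span_fields X P) x = span_fields X (predC P) x.
Proof.
move=> Ux; apply/seteqP; split=> v.
  move=> ov; apply/span_fieldsP => // k; rewrite negbK => Pk; rewrite g_sym.
  apply: ov; exists (fun i => (i == k)%:R).
  rewrite (bigD1 k)//= eqxx scale1r big1 ?addr0// => i /andP[_ /negPf ->].
  by rewrite scale0r.
move=> /span_fieldsP -/(_ Ux) v0 u [a ->]; rewrite metric_suml big1// => i Pi.
by rewrite g_sym v0 ?mulr0//= Pi.
Qed.

(** Supplies the constant rank for [smooth_distr], and the row-free matrix that is compared with the
    multiplicity of [eta]. *)
Lemma span_fields_basis (P : pred 'I_n) y : U y ->
  let B := \matrix_(i < #|P|) X (enum_val i) y in
  row_free B /\ span_fields X P y = [set v | (v <= B)%MS].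
Proof.
move=> Uy B; split.
  rewrite -kermx_eq0; apply/eqP/row_matrixP => i; rewrite row0.
  set a := row i _.
  have : a *m B = 0 by rewrite /a -row_mul mulmx_ker row0.
  rewrite mulmx_sum_row; under eq_bigr do rewrite rowK.
  move=> a0; apply/rowP => j; rewrite [RHS]mxE.
  have := congr1 ((g y)^~ (X (enum_val j) y)) a0.
  rewrite [in RHS]g_sym metric0r metric_suml.
  under eq_bigr do rewrite X_orth// (inj_eq enum_val_inj) mulrC eq_sym.
  by rewrite sum_delta.
apply/seteqP; split=> v /=.
  move=> [a ->].
  have -> : \sum_(i < n | P i) a i *: X i y
      = \sum_(i in P) a i *: X i y by [].
  rewrite big_enum_val.
  apply/submxP; exists (\row_i a (enum_val i)).
  by rewrite mulmx_sum_row; apply: eq_bigr => i _; rewrite mxE rowK.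
move=> /submxP[D ->]; apply/span_fieldsP => // k Pk.
rewrite mulmx_sum_row; under eq_bigr do rewrite rowK.
rewrite metric_suml big1// => i _; rewrite X_orth//.
case: eqVneq => [ik|_]; last by rewrite mulr0.
by have : P (enum_val i) := enum_valP i; rewrite ik (negPf Pk).
Qed.

Lemma smooth_distr_span (P : pred 'I_n) : smooth_distr U (span_fields X P).
Proof.
exists #|P| => x Ux; exists U, (fun i : 'I_#|P| => X (enum_val i)); split=> //.
  by move=> i; exact: sX.
by move=> y Uy; exact: span_fields_basis.
Qed.

Lemma integrable_distr_eq (E E' : distr M) : (forall x, U x -> E x = E' x) ->
  integrable_distr U E -> integrable_distr U E'.
Proof.
move=> EE' [[r sE] iE]; split.
  exists r => x Ux; have [V [Y [Vo Vx VU sY HY]]] := sE x Ux.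
  exists V, Y; split=> // y Vy; rewrite -EE'; [exact: HY|exact: VU].
move=> V T S Vo VU [sT ET] [sS ES] x Vx; rewrite -EE'; last exact: VU.
apply: (iE V T S) => //; split=> // y Vy; rewrite EE'.
- exact: ET.
- exact: VU.
- exact: ES.
- exact: VU.
Qed.

Lemma umbilical_eq (E E' : distr M) : (forall x, U x -> E x = E' x) ->
  umbilical g nabla U E -> umbilical g nabla U E'.
Proof.
move=> EE' [d [[sd od] H]]; exists d.
have oE x : U x -> orth_distr g E x = orth_distr g E' x.
  by move=> Ux; rewrite /orth_distr EE'.
split; first by split=> // x Ux; rewrite -oE//; exact: od.
move=> V T S Y Vo VU [sT ET] [sS ES] [sY oY] x Vx.
apply: (H V) => //; split=> // y Vy; [| |rewrite oE]; try exact: VU.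
- by rewrite EE'; [exact: ET|exact: VU].
- by rewrite EE'; [exact: ES|exact: VU].
- exact: oY.
Qed.

(** By torsion-freeness the component of the bracket along [X k] is the sum of
    [T_i S_j (G i j k - G j i k)] over [i], [j] in [P], where the terms with [i = j] vanish by
    themselves. *)
Lemma integrable_span (P : pred 'I_n) :
  (forall x, U x -> forall i j k, i != j -> P i -> P j -> ~~ P k ->
     G i j k x = G j i k x) ->
  integrable_distr U (span_fields X P).
Proof.
move=> HG; split; first exact: smooth_distr_span.
move=> V T S Vo VU [sT ET] [sS ES] x Vx; have Ux := VU _ Vx.
apply/span_fieldsP => // k Pk.
have s0 : smooth_fun V (fun _ : M => 0 : R) by exact: smooth_fun_cst.
have [_ /(_ x Vx) [_ _ _ <- _]] := g_lc Vo sT sS (sX k VU) s0.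
have Tk y i : V y -> ~~ P i -> g y (T y) (X i y) = 0.
  by move=> Vy; move: i; apply/span_fieldsP; [exact: VU|exact: ET].
have Sk y i : V y -> ~~ P i -> g y (S y) (X i y) = 0.
  by move=> Vy; move: i; apply/span_fieldsP; [exact: VU|exact: ES].
rewrite metric_subl (nabla_christoffel Vo VU Vx sT sS (fun y Vy => Sk y k Vy Pk)).
rewrite (nabla_christoffel Vo VU Vx sS sT (fun y Vy => Tk y k Vy Pk)).
rewrite [X in _ - X]exchange_big -sumrB big1// => i _.
rewrite -sumrB big1// => j _.
have [Pi|Pi] := boolP (P i); last by rewrite (Tk _ _ Vx Pi) mulr0 !mul0r subrr.
have [Pj|Pj] := boolP (P j); last by rewrite (Sk _ _ Vx Pj) mulr0 !mul0r subrr.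
have [<-|ij] := eqVneq i j; first by rewrite [X in X * _ - _]mulrC subrr.
by rewrite (HG x Ux i j k)// [X in X * _ - _]mulrC subrr.
Qed.

(** Testing with [T = S = X a] forces the component of the mean curvature vector along [X k] to be
    [G a a k]; this is the witness. *)
Lemma umbilical_span (P : pred 'I_n) a : P a ->
  (forall x, U x -> forall i j k, P i -> P j -> ~~ P k ->
     G i j k x = (i == j)%:R * G a a k x) ->
  umbilical g nabla U (span_fields X P).
Proof.
move=> Pa HG; exists (fun x => \sum_(k | ~~ P k) G a a k x *: X k x).
split.
  split.
    by apply: smooth_vf_sum => // k _; [exact: smooth_christoffel|exact: sX].
  by move=> x Ux; rewrite orth_span_fields//; exists (fun k => G a a k x).
move=> V T S Y Vo VU [sT ET] [sS ES] [sY oY] x Vx; have Ux := VU _ Vx.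
have Tk i : ~~ P i -> g x (T x) (X i x) = 0.
  by move: i; apply/span_fieldsP => //; exact: ET.
have Sk y i : V y -> ~~ P i -> g y (S y) (X i y) = 0.
  by move=> Vy; move: i; apply/span_fieldsP; [exact: VU|exact: ES].
have [b ->] : span_fields X (predC P) x (Y x).
  by rewrite -orth_span_fields//; exact: oY.
rewrite !metric_sumr mulr_sumr; apply: eq_bigr => k Pk.
rewrite mulrCA; congr (_ * _).
rewrite (nabla_christoffel Vo VU Vx sT sS (fun y Vy => Sk y k Vy Pk)).
have -> : g x (\sum_(k | ~~ P k) G a a k x *: X k x) (X k x) = G a a k x.
  rewrite metric_suml (bigD1 k)//= X_orth// eqxx mulr1 big1 ?addr0//.
  by move=> i /andP[_ /negPf ik]; rewrite X_orth// ik mulr0.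
have -> : g x (T x) (S x) = \sum_i g x (T x) (X i x) * g x (S x) (X i x).
  rewrite {1}(X_expand Ux (S x)) metric_sumr.
  by apply: eq_bigr => i _; rewrite mulrC.
rewrite mulr_suml; apply: eq_bigr => i _.
have [Pi|Pi] := boolP (P i); last first.
  by rewrite (Tk _ Pi) !mul0r big1// => j _; rewrite !mul0r.
transitivity (\sum_j (i == j)%:R
    * (g x (T x) (X i x) * g x (S x) (X j x) * G a a k x)).
  apply: eq_bigr => j _.
  have [Pj|Pj] := boolP (P j); last by rewrite (Sk _ _ Vx Pj) mulr0 !mul0r mulr0.
  by rewrite (HG x Ux i j k)// mulrCA.
by rewrite sum_delta.
Qed.

(** * The TP conditions in terms of Christoffel symbols *)

Section LinesAndBlock.
Variables (k0 : nat) (Delta : distr M) (a0 : 'I_n).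
Hypothesis Delta_span : forall x, U x ->
  Delta x = span_fields X (fun i : 'I_n => (k0 <= i)%N) x.
Hypothesis k0_a0 : (k0 <= a0)%N.
Hypothesis G_off : forall x, U x -> forall i j k : 'I_n,
  i != j -> j != k -> i != k -> ((j < k0) || (k < k0))%N -> G i j k x = 0.
Hypothesis G_diag : forall x, U x -> forall a b j : 'I_n,
  (k0 <= a)%N -> (k0 <= b)%N -> (j < k0)%N -> G a a j x = G b b j x.

Let idx := option {i : 'I_n | (i < k0)%N}.
(* [insub] sends [i < k0] to its own line and the other indices to the block. *)
Let block (b : idx) : pred 'I_n := fun i => insub i == b.

Let block_Some (i : {i : 'I_n | (i < k0)%N}) j : block (Some i) j = (j == val i).
Proof.
rewrite /block; case: insubP => [u uj <-|jk]; first by rewrite (inj_eq Some_inj).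
by apply/esym/negP => /eqP ji; move: jk; rewrite ji (valP i).
Qed.

Let block_None j : block None j = (k0 <= j)%N.
Proof.
rewrite /block; case: insubP => [u /= uj _|]; first by rewrite leqNgt uj.
by rewrite -leqNgt => ->.
Qed.

Let lines_span b x : U x ->
  lines_and k0 X Delta b x = span_fields X (block b) x.
Proof.
move=> Ux; case: b => [i|] /=.
  by congr (span_fields X _ x); apply/funext => j; rewrite block_Some.
rewrite Delta_span//.
by congr (span_fields X _ x); apply/funext => j; rewrite block_None.
Qed.

(** On three distinct indices every condition tests some [G i j k] with [j] or [k] below [k0]: [k]
    for the block and for the complement of a line, [j] for the complement of the block. A line,
    spanned by one field, imposes nothing. [G_diag] serves for the umbilicity of the block. *)
Lemma TP_net_lines_and : TP_net g nabla U (lines_and k0 X Delta).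
Proof.
split; first split; first split.
(* The frame components of [v], grouped by block; uniqueness holds because each summand has no
   component outside its own block. *)
- move=> x Ux v; pose u := [ffun b : idx => \sum_(i | block b i) g x v (X i x) *: X i x].
  exists u; split.
    split; first by move=> b; rewrite lines_span// ffunE; exists (fun i => g x v (X i x)).
    rewrite {1}(X_expand Ux v) (partition_big (fun i : 'I_n => insub i : idx) predT)//=.
    by apply: eq_bigr => b _; rewrite ffunE.
  move=> u' [Eu' vu']; apply/ffunP => b; rewrite ffunE.
  have u'0 c i : ~~ block c i -> g x (u' c) (X i x) = 0.
    by move: i; apply/span_fieldsP => //; rewrite -lines_span//; exact: Eu'.
  rewrite [RHS](X_expand Ux (u' b)) big_mkcond; apply: eq_bigr => i _.
  case: ifPn => [bi|/u'0 ->]; last by rewrite scale0r.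
  congr (_ *: _); rewrite vu'.
  have -> : \sum_c u' c = \sum_c 1 *: u' c by under [RHS]eq_bigr do rewrite scale1r.
  rewrite metric_suml (bigD1 b)//= mul1r big1 ?addr0// => c cb.
  rewrite mul1r u'0//; apply: contra cb => /eqP <-.
  exact: bi.
- move=> b; apply: (@integrable_distr_eq (span_fields X (block b))).
    by move=> x Ux; rewrite lines_span.
  apply: integrable_span => x Ux i j k ij; case: b => [c|].
    by rewrite !block_Some => /eqP ic /eqP jc; rewrite ic jc eqxx in ij.
  rewrite !block_None => ik jk; rewrite -ltnNge => kk.
  have neq l : (k0 <= l)%N -> l != k by apply: contraTneq => ->; rewrite -ltnNge.
  by rewrite !G_off ?neq ?kk ?orbT// eq_sym.
- move=> x Ux b c u v bc; rewrite !lines_span// => -[a ->] Ev.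
  rewrite metric_suml big1// => i /eqP bi; rewrite g_sym.
  have /span_fieldsP -/(_ Ux) -> := Ev; first by rewrite mulr0.
  by rewrite /block bi.
- move=> b; apply: (@umbilical_eq (span_fields X (block b))).
    by move=> x Ux; rewrite lines_span.
  case: b => [c|].
    apply: (@umbilical_span _ (val c)); first by rewrite block_Some.
    move=> x Ux i j k; rewrite !block_Some => /eqP -> /eqP -> _.
    by rewrite eqxx mul1r.
  apply: (@umbilical_span _ a0); first by rewrite block_None.
  move=> x Ux i j k; rewrite !block_None => ik jk; rewrite -ltnNge => kk.
  have neq l : (k0 <= l)%N -> l != k by apply: contraTneq => ->; rewrite -ltnNge.
  have [<-|ij] := eqVneq i j; first by rewrite mul1r (G_diag Ux ik k0_a0 kk).
  by rewrite mul0r G_off ?neq ?kk ?orbT.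
- move=> b; apply: (@integrable_distr_eq (span_fields X (predC (block b)))).
    move=> x Ux; rewrite -orth_span_fields//.
    by rewrite /orth_distr lines_span.
  apply: integrable_span => x Ux i j k ij; case: b => [c|].
    rewrite /= negbK !block_Some => ic jc /eqP kE; subst k.
    by rewrite !G_off// ?(valP c) ?orbT// eq_sym.
  rewrite /= negbK !block_None -!ltnNge => ik jk kk.
  have neq l : (l < k0)%N -> l != k.
    by move=> lk; apply: contraTneq lk => ->; rewrite -leqNgt.
  by rewrite !G_off ?neq ?ik ?jk// eq_sym.
Qed.

End LinesAndBlock.

End FrameConnection.

(** * The Moebius metric *)

(** Testing on [w = e j] gives [G v (e j) *: (S (e j) (e j) - c *: h) = 0]; the converse expands [w]
    in the frame. The factor [c] is there because principal normals refer to the induced metric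
    while the frame is orthonormal for the Moebius one. *)
Lemma diagonal_form_eigen {R : realType} {n m : nat}
    (S : 'rV[R]_n -> 'rV[R]_n -> 'rV[R]_m) (G : 'rV[R]_n -> 'rV[R]_n -> R)
    (e : 'I_n -> 'rV[R]_n) (c : R) (h : 'rV[R]_m) :
  (forall a u v w, S (a *: u + v) w = a *: S u w + S v w) ->
  (forall u v, S u v = S v u) -> (forall u v, G u v = G v u) ->
  (forall v, v = \sum_i G v (e i) *: e i) ->
  (forall i j, i != j -> S (e i) (e j) = 0) ->
  (forall a u v w, G (a *: u + v) w = a * G u w + G v w) ->
  forall v, (forall w, S v w = (c * G v w) *: h) <->
    (forall j, S (e j) (e j) != c *: h -> G v (e j) = 0).
Proof.
move=> Slin Ssym Gsym Xex Sdiag Glin v.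
have S0 w : S 0 w = 0.
  have := Slin (- 1) 0 0 w; rewrite scaler0 addr0 scaleN1r => ->.
  by rewrite addNr.
have G0 w : G 0 w = 0.
  have := Glin (- 1) 0 0 w; rewrite scaler0 addr0 mulN1r => ->.
  by rewrite addNr.
have Ssum (a : 'I_n -> R) w : S (\sum_i a i *: e i) w = \sum_i a i *: S (e i) w.
  by elim/big_rec2: _ => [|i y z _ <-]; [exact: S0|rewrite Slin].
have Gsum (a : 'I_n -> R) w : G (\sum_i a i *: e i) w = \sum_i a i * G (e i) w.
  by elim/big_rec2: _ => [|i y z _ <-]; [exact: G0|rewrite Glin].
have Se z j : S z (e j) = G z (e j) *: S (e j) (e j).
  rewrite {1}(Xex z) Ssum (bigD1 j)//= big1 ?addr0// => i ij.
  by rewrite Sdiag// scaler0.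
split=> [Ev j|v0 w].
  apply: contraNeq => gj0; apply/eqP.
  have := Ev (e j); rewrite Se mulrC -scalerA => /eqP.
  by rewrite -subr_eq0 -scalerBr scaler_eq0 (negPf gj0) subr_eq0 => /eqP.
rewrite Ssym {1}(Xex w) Ssum (Gsym v) [in RHS](Xex w) Gsum mulr_sumr scaler_suml.
apply: eq_bigr => j _; rewrite (Ssym _ v) Se (Gsym (e j)).
have [/eqP ->|/v0 ->] := boolP (S (e j) (e j) == c *: h).
  by rewrite !scalerA mulrA mulrC mulrA.
by rewrite !mulr0 !scale0r scaler0.
Qed.

(** [h] is the value shared by two distinct indices of Delta, with potentials [c] and [d]. Two are
    needed, since the Gauss relation gives [h . h] only for a pair of distinct indices. *)
Lemma dotp_sub_eq0 {R : realType} {m : nat} (u v h : 'rV[R]_m) (a b c d : R) :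
  dotp u v = a + b -> dotp u h = a + c -> dotp h v = d + b ->
  dotp h h = d + c -> dotp (u - h) (v - h) = 0.
Proof.
rewrite dotpBl !dotpBr => -> -> -> ->; ring.
Qed.

Lemma dotp_sub_eq {R : realType} {m : nat} (u v w : 'rV[R]_m) :
  dotp (u - v) w = 0 -> dotp u w = dotp v w.
Proof. by rewrite dotpBl => /subr0_eq. Qed.

Lemma normal_vec_sub {R : realType} {n m : nat} {M : manifold R n}
    (f : M -> 'rV[R]_m) x (u v : 'rV[R]_m) :
  normal_vec f x u -> normal_vec f x v -> normal_vec f x (u - v).
Proof. by move=> nu nv w; rewrite dotpBl nu nv subrr. Qed.

(* A difference tensor symmetric in its first two indices and antisymmetric in
   its last two vanishes. *)
Lemma koszul_unique {R : realType} {I : eqType} (G A : I -> I -> I -> R) :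
  (forall i j k, G i j k = - G i k j) ->
  (forall i j k, j != k -> A i j k + A i k j = 0) ->
  (forall i j k, G i j k - G j i k = A i j k - A j i k) ->
  forall i j k, i != j -> j != k -> i != k -> G i j k = A i j k.
Proof.
move=> Ga Aa GA i j k ij jk ik; have ki : k != i by rewrite eq_sym.
have := GA i j k; have := GA j k i; have := GA k i j.
have := Aa i j k jk; have := Aa j k i ki; have := Aa k i j ij.
have := Ga i j k; have := Ga j k i; have := Ga k i j.
move: (G i j k) (G i k j) (G j k i) (G j i k) (G k i j) (G k j i).
by move: (A i j k) (A i k j) (A j k i) (A j i k) (A k i j) (A k j i) => *; lra.
Qed.

Section MoebiusFrame.
Context {R : realType} {n m : nat} {M : manifold R n}.
Variables (f : M -> 'rV[R]_m) (eta : M -> 'rV[R]_m).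
Variables (nabla : vfield M -> vfield M -> vfield M).
Variables (U : set M) (X : 'I_n -> vfield M) (k0 : nat) (i0 : 'I_n).
Hypothesis f_imm : immersion f.
Hypothesis Uo : open U.
Hypothesis nabla_lc : levi_civita (moebius_metric f) nabla.
Hypothesis X_frame : orthonormal_frame (moebius_metric f) U X.
Hypothesis beta_diag : forall x, U x -> forall i j : 'I_n, i != j ->
  moebius_sff f x (X i x) (X j x) = 0.
Hypothesis beta_eta : forall x, U x -> forall i : 'I_n, (k0 <= i)%N ->
  moebius_sff f x (X i x) (X i x) = moebius_normal f eta x.

Local Notation gs := (moebius_metric f).

Definition conf_factor (x : M) : R := (rho f x ^+ 2)^-1.
Local Notation s := conf_factor.

Lemma moebius_linear x a u v w : gs x (a *: u + v) w = a * gs x u w + gs x v w.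
Proof.
have lin := dM_linear a u v (diff_at_imm f_imm x).
by rewrite /moebius_metric /induced_metric lin dotp_linear mulrDr mulrCA.
Qed.

Lemma moebius_sym x u v : gs x u v = gs x v u.
Proof. by rewrite /moebius_metric /induced_metric dotpC. Qed.

(** A vector of Moebius length one exists, so the factor [rho ^+ 2] of the metric cannot vanish. *)
Lemma rho_neq0 x : U x -> rho f x != 0.
Proof.
move=> Ux; apply: contraPneq (X_frame.2 x Ux i0 i0) => r0.
by rewrite /moebius_metric r0 expr0n mul0r eqxx => /eqP; rewrite eq_sym oner_eq0.
Qed.

Lemma conf_factor_neq0 x : U x -> s x != 0.
Proof. by move=> Ux; rewrite invr_neq0// expf_neq0// rho_neq0. Qed.

Lemma induced_orth x : U x -> forall i j,
  dotp (dM f x (X i x)) (dM f x (X j x)) = (i == j)%:R * s x.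
Proof.
move=> Ux i j; rewrite -(X_frame.2 x Ux i j) /moebius_metric /induced_metric.
by rewrite mulrAC mulfV ?mul1r// expf_neq0// rho_neq0.
Qed.

(** Instead of following the traces and the square root in [rho], [s] is recognized as the squared
    length of [X_i0(f)]. *)
Lemma smooth_conf_factor : smooth_fun U s.
Proof.
have sf1 : smooth_fun U (vder (X i0) f).
  apply: (smooth_vder Uo (X_frame.1 i0)).
  exact: smooth_fun_subset f_imm.1.
apply: smooth_fun_eq Uo _ (smooth_fun_dotp Uo sf1 sf1) => y Uy.
by rewrite [LHS](induced_orth Uy) eqxx mul1r.
Qed.

Lemma smooth_moebius (V : set M) (T S : vfield M) : open V -> V `<=` U ->
  smooth_vf V T -> smooth_vf V S -> smooth_fun V (fun x => gs x (T x) (S x)).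
Proof.
move=> Vo VU sT sS.
have sf : smooth_fun V f by exact: smooth_fun_subset f_imm.1.
have ss : smooth_fun V (fun y => (s y)^-1).
  apply: smooth_fun_inv => //; first by move=> y /VU; exact: conf_factor_neq0.
  exact: smooth_fun_subset VU smooth_conf_factor.
have sd := smooth_fun_dotp Vo (smooth_vder Vo sT sf) (smooth_vder Vo sS sf).
apply: smooth_fun_eq Vo _ (smooth_fun_mul Vo ss sd) => y _.
by rewrite /conf_factor invrK.
Qed.

Lemma moebius_expand x : U x -> forall v, v = \sum_i gs x v (X i x) *: X i x.
Proof.
move=> Ux v.
rewrite {1}(frame_expand f_imm (conf_factor_neq0 Ux) (induced_orth Ux) v).
by apply: eq_bigr => i _; rewrite /conf_factor invrK mulrC.
Qed.

Lemma sff_frame_diag x : U x -> forall i j, i != j ->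
  sff f x (X i x) (X j x) = 0.
Proof.
move=> Ux i j ij; have /eqP := beta_diag Ux ij.
rewrite /moebius_sff scaler_eq0 (negPf (rho_neq0 Ux))/= /induced_metric.
by rewrite (induced_orth Ux) (negPf ij) mul0r scale0r subr0 => /eqP.
Qed.

Lemma sff_frame_eta x (i : 'I_n) : U x -> (k0 <= i)%N ->
  sff f x (X i x) (X i x) = s x *: eta x.
Proof.
move=> Ux ki; have r0 := rho_neq0 Ux.
have := beta_eta Ux ki; rewrite /moebius_sff /moebius_normal /induced_metric.
rewrite (induced_orth Ux) eqxx mul1r; move: (mean_curv f x) => H.
move=> /(congr1 (fun w => (rho f x)^-1 *: w)).
rewrite !scalerA mulVf// scale1r scalerBr -invfM -expr2 => E.
exact: (addIr (- (s x *: H))).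
Qed.

Local Notation al i x := (sff f x (X i x) (X i x)).

Lemma E_pn_span x : U x ->
  E_pn f eta x = span_fields X (fun j => al j x == s x *: eta x) x.
Proof.
move=> Ux.
have indE v w : induced_metric f x v w = s x * gs x v w.
  by rewrite /moebius_metric mulrA mulVf ?mul1r// expf_neq0// rho_neq0.
have key := diagonal_form_eigen (s x) (eta x) (sff_linearl f_imm x)
  (sff_sym f_imm x) (@moebius_sym x) (moebius_expand Ux) (sff_frame_diag Ux)
  (@moebius_linear x).
have spanP := span_fieldsP moebius_linear X_frame moebius_expand
  (fun j => al j x == s x *: eta x) _ Ux.
apply/seteqP; split=> v.
  by move=> Ev; apply/spanP; apply/key => w; rewrite -indE; exact: Ev.
by move=> /spanP v0 w; rewrite indE; move: w; apply/key.
Qed.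

Hypothesis E_dim : forall x, U x -> has_dim (E_pn f eta x) (n - k0).

(** [beta_eta] gives one inclusion between index sets; the multiplicity of [eta] makes their
    cardinals equal. Hence no index outside Delta shares the principal normal [eta]. *)
Lemma sff_frame_etaP x (i : 'I_n) : U x -> (al i x == s x *: eta x) = (k0 <= i)%N.
Proof.
move=> Ux; pose P i := al i x == s x *: eta x.
pose Q (j : 'I_n) := (k0 <= j)%N.
have sub : Q \subset P.
  by apply/fintype.subsetP => j kj; apply/eqP; exact: sff_frame_eta.
have [B [Bfree EB]] := E_dim Ux.
have [Xfree XE] := span_fields_basis moebius_linear moebius_sym X_frame
  moebius_expand P Ux.
(* Two row-free matrices with the same row space have equally many rows. *)
have cardP : #|P| = (n - k0)%N.
  have EqBX : [set v : 'rV[R]_n | (v <= B)%MS]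
      = [set v | (v <= \matrix_(i < #|P|) X (enum_val i) x)%MS].
    by rewrite -EB -XE E_pn_span.
  have le1 : (B <= \matrix_(i < #|P|) X (enum_val i) x)%MS.
    apply/row_subP => j; suff : [set v : 'rV[R]_n | (v <= B)%MS] (row j B).
      by rewrite EqBX.
    exact: row_sub.
  have le2 : (\matrix_(i < #|P|) X (enum_val i) x <= B)%MS.
    apply/row_subP => j; set w := row j _.
    suff : [set v | (v <= \matrix_(i < #|P|) X (enum_val i) x)%MS] w.
      by rewrite -EqBX.
    exact: row_sub.
  apply/eqP; rewrite eqn_leq -{1}(eqP Xfree) -{2}(eqP Bfree).
  by rewrite (leq_trans (mxrankS le2) (rank_leq_row _))
    (leq_trans (mxrankS le1) (rank_leq_row _)).
have cardQ : #|Q| = (n - k0)%N.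
  by rewrite -sum1_card; have := sum_nat_const_nat k0 n 1; rewrite big_geq_mkord muln1.
by have /(subset_cardP (etrans cardQ (esym cardP)))/(_ i) := sub.
Qed.

Lemma E_pn_block x : U x ->
  E_pn f eta x = span_fields X (fun j : 'I_n => (k0 <= j)%N) x.
Proof.
move=> Ux; rewrite E_pn_span//; congr (span_fields X _ x).
by apply/funext => j; rewrite sff_frame_etaP.
Qed.

(** * Christoffel symbols of the Moebius metric *)

Variable g : metric_field M.
Hypothesis g_flat : conformally_flat g.
Hypothesis gE : forall x u v, g x u v = induced_metric f x u v.
Variables a0 b0 : 'I_n.
Hypotheses (k0_a0 : (k0 <= a0)%N) (k0_b0 : (k0 <= b0)%N) (ab0 : a0 != b0).

Let va i x := al i x - s x *: eta x.

Let va_eq0 x (i : 'I_n) : U x -> (va i x == 0) = (k0 <= i)%N.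
Proof. by move=> Ux; rewrite subr_eq0 sff_frame_etaP. Qed.

(* Conformal flatness gives [al i . al j = P i + P j] for [i <> j]; expanding
   [(al i - al a0) . (al j - al b0)] the [P]'s cancel. *)
Let va_orth x (i j : 'I_n) : U x -> i != j -> dotp (va i x) (va j x) = 0.
Proof.
move=> Ux ij.
have [ki|ki] := leqP k0 i.
  by have := va_eq0 i Ux; rewrite ki => /eqP ->; rewrite dotp0l.
have [kj|kj] := leqP k0 j.
  by have := va_eq0 j Ux; rewrite kj => /eqP ->; rewrite dotp0r.
have [P HP] := conformally_flat_sff (e := fun i => X i x) f_imm g_flat gE
  (conf_factor_neq0 Ux) (induced_orth Ux).
have alP k l : k != l -> dotp (al k x) (al l x) = P k + P l.
  by move=> kl; rewrite -HP// (sff_frame_diag Ux kl) dotp0l subr0.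
have neq (k : 'I_n) (c : 'I_n) : (k < k0)%N -> (k0 <= c)%N -> k != c.
  by move=> kk kc; apply: contraTneq kk => ->; rewrite -leqNgt.
have E1 := alP i j ij.
have E2 := alP i a0 (neq _ _ ki k0_a0); rewrite (sff_frame_eta Ux k0_a0) in E2.
have jb0 : b0 != j by rewrite eq_sym; exact: neq.
have E3 := alP b0 j jb0; rewrite (sff_frame_eta Ux k0_b0) in E3.
have ba0 : b0 != a0 by rewrite eq_sym.
have E4 := alP b0 a0 ba0.
rewrite (sff_frame_eta Ux k0_b0) (sff_frame_eta Ux k0_a0) in E4.
exact: dotp_sub_eq0 E1 E2 E3 E4.
Qed.

Let va_normal x i : U x -> normal_vec f x (va i x).
Proof.
move=> Ux; apply: normal_vec_sub; first exact: sff_normal.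
by rewrite -(sff_frame_eta Ux k0_a0); exact: sff_normal.
Qed.

Let va_gt0 x (i : 'I_n) : U x -> (i < k0)%N -> dotp (va i x) (va i x) != 0.
Proof.
move=> Ux ik; rewrite gt_eqF// dotp_gt0// va_eq0// -ltnNge.
by [].
Qed.

(** Against [va j], every index other than [j] looks like an index of Delta; this is how
    orthogonality enters the Codazzi equations. *)
Let dotp_al x i j : U x -> i != j ->
  dotp (al i x) (va j x) = dotp (s x *: eta x) (va j x).
Proof.
by move=> Ux ij; exact: dotp_sub_eq (va_orth Ux ij).
Qed.

Local Notation A := (frame_coef f X s).
Local Notation G := (christoffel gs nabla X).

Let sX i : smooth_vf U (X i). Proof. exact: X_frame.1. Qed.

Let A_deriv i j k x : U x ->
  A i j k x + A i k j x = (j == k)%:R * (vder (X i) s x / s x).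
Proof.
exact: (frame_coef_deriv f_imm Uo sX smooth_conf_factor induced_orth).
Qed.

(** With [xi = va j], the indices [i] and [k] give the same number, so the right side of Codazzi
    vanishes and the left side is [A i j k] times the squared norm of [va j]. *)
Let A_off1 x (i j k : 'I_n) : U x -> i != j -> j != k -> i != k ->
  (j < k0)%N -> A i j k x = 0.
Proof.
move=> Ux ij jk ik jk0.
have kj : k != j by rewrite eq_sym.
have H : A i j k x * (dotp (al j x) (va j x) - dotp (al k x) (va j x))
    = A j i k x * (dotp (al i x) (va j x) - dotp (al k x) (va j x)).
  exact: (codazzi_distinct f_imm Uo sX smooth_conf_factor conf_factor_neq0
    induced_orth sff_frame_diag Ux (va_normal j Ux) ij jk ik).
have Ei := dotp_al Ux ij; have Ek := dotp_al Ux kj.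
have Ej : dotp (al j x) (va j x) - dotp (s x *: eta x) (va j x)
  = dotp (va j x) (va j x) by exact/esym/dotpBl.
have v0 := va_gt0 Ux jk0.
have coef0 (p q b c d h v : R) : p * (b - c) = q * (d - c) -> d = h -> c = h ->
    b - h = v -> v != 0 -> p = 0.
  move=> E dE cE bE vn0; move: E; rewrite dE cE bE subrr mulr0 => /eqP.
  by rewrite mulf_eq0 (negPf vn0) orbF => /eqP.
exact: coef0 H Ei Ek Ej v0.
Qed.

Let A_off x (i j k : 'I_n) : U x -> i != j -> j != k -> i != k ->
  ((j < k0) || (k < k0))%N -> A i j k x = 0.
Proof.
move=> Ux ij jk ik /orP[jk0|kk0]; first exact: A_off1.
have := A_deriv i j k Ux; rewrite (negPf jk) mul0r.
by rewrite (@A_off1 x i k j)// 1?eq_sym// addr0.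
Qed.

Let G_torsion x i j k : U x -> G i j k x - G j i k x = A i j k x - A j i k x.
Proof.
move=> Ux; rewrite (christoffel_torsion moebius_linear nabla_lc Uo X_frame i j k Ux).
rewrite (frame_bracket_expand f_imm Uo sX conf_factor_neq0
  induced_orth i j Ux).
rewrite (metric_suml moebius_linear) (bigD1 k)//= (X_frame.2 x Ux) eqxx mulr1.
rewrite big1 ?addr0// => l /negPf lk.
by rewrite (X_frame.2 x Ux) lk mulr0.
Qed.

Let G_antisym x i j k : U x -> G i j k x = - G i k j x.
Proof. exact: (christoffel_antisym moebius_sym nabla_lc Uo X_frame). Qed.

Let G_eqA x i j k : U x -> i != j -> j != k -> i != k -> G i j k x = A i j k x.
Proof.
move=> Ux; apply: (koszul_unique (G := fun i j k => G i j k x)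
  (A := fun i j k => A i j k x)) => {i j k} i j k; first exact: G_antisym.
- by move=> /negPf jk; rewrite (A_deriv i j k Ux) jk mul0r.
- exact: G_torsion.
Qed.

Let G_off x (i j k : 'I_n) : U x -> i != j -> j != k -> i != k ->
  ((j < k0) || (k < k0))%N -> G i j k x = 0.
Proof. by move=> Ux ij jk ik H; rewrite G_eqA// A_off. Qed.

Let G_diag x (a b j : 'I_n) : U x -> (k0 <= a)%N -> (k0 <= b)%N -> (j < k0)%N ->
  G a a j x = G b b j x.
Proof.
move=> Ux ka kb jk.
have neq (c : 'I_n) : (k0 <= c)%N -> j != c.
  by move=> kc; apply: contraTneq jk => ->; rewrite -leqNgt.
(* The torsion identity on [(c, j, c)], where [G j c c = 0] but [A j c c] is half of
   [X_j(s) / s]. *)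
have Gc (c : 'I_n) : (k0 <= c)%N ->
    G c c j x = vder (X j) s x / s x / 2 - A c j c x.
  have diag (q q' r t t' u : R) : q = - q' -> r = - r -> q' - r = t - t' ->
    t' + t' = u -> q = u / 2 - t by move=> *; lra.
  move=> kc; apply: diag (G_antisym c c j Ux) (G_antisym j c c Ux)
    (G_torsion c j c Ux) _.
  by have := A_deriv j c c Ux; rewrite eqxx mul1r.
rewrite !Gc//; congr (_ - _).
(* Multiplied by the squared norm of [va j], [A c j c] becomes an expression in the data of [eta],
   independent of [c]. *)
apply: (mulIf (va_gt0 Ux jk)).
have E (c : 'I_n) : (k0 <= c)%N -> A c j c x * dotp (va j x) (va j x)
    = dotp (vder (X j) (frame_normal f X s c c) x) (va j x)
      - vder (X j) s x / s x * dotp (s x *: eta x) (va j x).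
  move=> kc; have jc := neq c kc; have cj : c != j by rewrite eq_sym.
  have H : A c j c x * (dotp (al j x) (va j x) - dotp (al c x) (va j x))
      = dotp (vder (X j) (frame_normal f X s c c) x) (va j x)
        - vder (X j) s x / s x * dotp (al c x) (va j x).
    exact: (codazzi_diag f_imm Uo sX smooth_conf_factor conf_factor_neq0
      induced_orth sff_frame_diag Ux (va_normal j Ux) jc).
  have subst (q d t b1 w h v : R) : q * (b1 - w) = d - t * w -> w = h ->
    b1 - h = v -> q * v = d - t * h by move=> qE wh <-; rewrite -wh.
  exact: subst H (dotp_al Ux cj) (esym (dotpBl _ _ _)).
(* The two normal components are compared on all of [U], because they are differentiated along
   [X j]. *)
have NE : vder (X j) (frame_normal f X s a a) x
    = vder (X j) (frame_normal f X s b b) x.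
  apply: (vder_near (X j) Uo Ux) => y Uy.
  have nE (c : 'I_n) : (k0 <= c)%N -> frame_normal f X s c c y = s y *: eta y.
    move=> kc; rewrite (frame_normalE f_imm Uo sX conf_factor_neq0 induced_orth c c Uy).
    exact: sff_frame_eta.
  exact: etrans (nE a ka) (esym (nE b kb)).
refine (etrans (E a ka) (etrans _ (esym (E b kb)))).
exact: (congr1 (fun w => dotp w (va j x) - _) NE).
Qed.

Lemma TP_net_principal :
  TP_net gs nabla U (lines_and k0 X (E_pn f eta)).
Proof.
apply: (TP_net_lines_and moebius_linear moebius_sym smooth_moebius nabla_lc Uo
  X_frame moebius_expand _ k0_a0).
- exact: E_pn_block.
- by move=> x Ux i j k; exact: G_off.
- by move=> x Ux a b j; exact: G_diag.
Qed.

End MoebiusFrame.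

Theorem corollary4p1 (R : realType) (n p l : nat)
    (hp : (2 <= p <= n - 3)%N) (hl : (l <= p - 2)%N)
    (M : manifold R n) (g : metric_field M) (f : M -> 'rV[R]_(n + p))
    (hg : riemannian g) (hconf : conformally_flat g)
    (hf : isometric_immersion g f)
    (humb : umbilic_free f) (hflat : flat_normal_bundle f) (hprop : is_proper f)
    (hclosed : closed_moebius_form f)
    (eta : M -> 'rV[R]_(n + p))
    (heta : principal_normal_field f eta (n - p + l))
    (nabla : vfield M -> vfield M -> vfield M)
    (hnabla : levi_civita (moebius_metric f) nabla)
    (U : set M) (hU : open U) (X : 'I_n -> vfield M)
    (hX : orthonormal_frame (moebius_metric f) U X)
    (hbeta : forall x, U x -> forall i j : 'I_n, i != j ->
       moebius_sff f x (X i x) (X j x) = 0)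
    (hpsi : forall x, U x -> forall i j : 'I_n, i != j ->
       blaschke f nabla (X i) (X j) x = 0)
    (hXeta : forall x, U x -> forall i : 'I_n, (p - l <= i)%N ->
       moebius_sff f x (X i x) (X i x) = moebius_normal f eta x) :
  (forall x, U x ->
     E_pn f eta x = span_fields X (fun i : 'I_n => (p - l <= i)%N) x) /\
  TP_net (moebius_metric f) nabla U (lines_and (p - l) X (E_pn f eta)).
Proof.
have [f_imm gE] := hf.
(* Indices start at 0 and the block has [n - p + l >= 3] elements, so the last two indices lie in
   it. *)
have a0n : (n - 1 < n)%N by lia.
have b0n : (n - 2 < n)%N by lia.
pose a0 := Ordinal a0n; pose b0 := Ordinal b0n.
(* The subtraction is truncated; the equality of the two dimensions rests on [l <= p <= n]. *)
have dimE x : U x -> has_dim (E_pn f eta x) (n - (p - l)).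
  move=> _; have [_ _] := heta.2 x.
  by have -> : (n - (p - l) = n - p + l)%N by lia.
split; first by move=> x Ux; exact: (E_pn_block a0 f_imm hX hbeta hXeta dimE).
apply: (@TP_net_principal _ _ _ _ f eta nabla U X (p - l) a0 f_imm hU hnabla hX
  hbeta hXeta dimE g hconf gE a0 b0) => /=; first by lia.
- by lia.
- by apply/eqP => /(congr1 val) /=; lia.
Qed.
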